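(* Let $G$ be a torsion-free group, and let $H$ be a finitely generated nilpotent group which is not virtually infinite cyclic. Assume that $G \curvearrowright X$ is a topologically free system on a compact space $X$ such that $G \curvearrowright X$ is almost $\mathbb{Z}G$-projective. Furthermore, let $H \curvearrowright Y$ be a topologically free system. If $G \curvearrowright X$ and $H \curvearrowright Y$ are continuously orbit equivalent, then they are conjugate.
   Context: All groups are discrete and countable; all topological spaces are locally compact and Hausdorff. A (topological dynamical) system $G \curvearrowright X$ is an action $(g,x) \mapsto g.x$ of a group $G$ on a space $X$ by homeomorphisms. It is topologically free if for every $e \neq g \in G$ the set $\{x \in X : g.x \neq x\}$ is dense in $X$. A system $G \curvearrowright X$ with $X$ compact is almost $\mathbb{Z}G$-projective if $C(X,\mathbb{Z}) \cong \mathbb{Z} \oplus P$ as $\mathbb{Z}G$-modules, where the copy of $\mathbb{Z}$ is given by the constant functions on $X$ and $P$ is a projective $\mathbb{Z}G$-module. Here $G$ acts on $C(X,\mathbb{Z})$ by $(g.f)(x) = f(g^{-1}.x)$. $G \curvearrowright X$ and $H \curvearrowright Y$ are continuously orbit equivalent if there exist a homeomorphism $\varphi: X \to Y$ with inverse $\psi$ and continuous maps $a: G \times X \to H$, $b: H \times Y \to G$ (with $G$, $H$ discrete) such that $\varphi(g.x) = a(g,x).\varphi(x)$ and $\psi(h.y) = b(h,y).\psi(y)$ for all $g,x,h,y$. They are conjugate if there are a homeomorphism $\varphi: X \to Y$ and a group isomorphism $\rho: G \to H$ with $\varphi(g.x) = \rho(g).\varphi(x)$ for all $g \in G$, $x \in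 X$. *)

(* Defs.v *)
From HB Require Import structures.
From mathcomp Require Import all_boot ssralg ssrint.
From mathcomp Require Import finmap.
From mathcomp.multinomials Require Import monalg.
From mathcomp Require Import boolp classical_sets functions cardinality.
From mathcomp Require Import topology.

Set Implicit Arguments.
Unset Strict Implicit.
Unset Printing Implicit Defensive.

Import GRing.Theory.

Local Open Scope classical_set_scope.
Local Open Scope ring_scope.

Section GroupTheory.
Local Open Scope group_scope.
Variable G : groupType.

Definition torsion_free : Prop :=
  forall (g : G) (n : nat), (0 < n)%N -> g ^+ n = 1 -> g = 1.

Definition is_subgroup (K : set G) : Prop :=
  K 1 /\ forall x y : G, K x -> K y -> K (x / y).

Definition generated (S : set G) : set G := smallest is_subgroup S.

Definition finitely_generated : Prop :=
  exists S : set G, finite_set S /\ generated S = [set: G].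

Fixpoint lower_central (n : nat) : set G :=
  if n is m.+1 then
    generated [set c | exists x y : G, lower_central m x /\ c = [~ x, y]]
  else [set: G].

Definition nilpotent_group : Prop :=
  exists n : nat, lower_central n = [set 1].

Definition left_coset (x : G) (K : set G) : set G := [set x * k | k in K].

Definition finite_index (K : set G) : Prop :=
  finite_set (range (fun x : G => left_coset x K)).

Definition infinite_cyclic (K : set G) : Prop :=
  infinite_set K /\ exists z : G, K = generated [set z].

Definition virtually_infinite_cyclic : Prop :=
  exists K : set G, [/\ is_subgroup K, finite_index K & infinite_cyclic K].

End GroupTheory.

Arguments torsion_free : clear implicits.
Arguments finitely_generated : clear implicits.
Arguments nilpotent_group : clear implicits.
Arguments virtually_infinite_cyclic : clear implicits.

(* [zlin h a] is the value at [a] of the Z-linear extension of [h : G -> V]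
   to finitely supported functions [G -> int]; [<< k >>] is the basis element
   attached to [k], so that [a = \sum_k a@_k << k >>]. *)
Section LinearExtension.
Variables (G : choiceType) (V : zmodType).
Implicit Types (h : G -> V) (a b : {malg int[G]}).

Definition zlin h a : V := \sum_(k <- msupp a) h k *~ a@_k.

Lemma zlinEw h a (d : {fset G}) :
  (msupp a `<=` d)%fset -> zlin h a = \sum_(k <- d) h k *~ a@_k.
Proof.
move=> sub; apply: big_fset_incl => // k _ /mcoeff_outdom ->.
by rewrite mulr0z.
Qed.

Lemma zlin_is_zmod_morphism h : zmod_morphism (zlin h).
Proof.
move=> a b; rewrite (zlinEw h (fsubsetUl (msupp a) (msupp b))).
rewrite (zlinEw h (fsubsetUr (msupp a) (msupp b))) (zlinEw h (msuppB_le a b)).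
rewrite -sumrB; apply: eq_bigr => k _.
by rewrite mcoeffB mulrzBr.
Qed.

HB.instance Definition _ h :=
  GRing.isZmodMorphism.Build {malg int[G]} V (zlin h) (zlin_is_zmod_morphism h).

Lemma zlinU h k : zlin h << k >> = h k.
Proof. by rewrite (zlinEw h msuppU_le) big_seq_fset1 mcoeffUU. Qed.

Lemma eq_zlin h1 h2 : h1 =1 h2 -> zlin h1 =1 zlin h2.
Proof. by move=> e a; apply: eq_bigr => k _; rewrite e. Qed.

Lemma zlinDf h1 h2 a : zlin (fun k => h1 k + h2 k) a = zlin h1 a + zlin h2 a.
Proof. by rewrite -big_split; apply: eq_bigr => k _; rewrite mulrzDl. Qed.

End LinearExtension.

Lemma zlin_comp (G : choiceType) (V W : zmodType) (phi : {additive V -> W})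
  (h : G -> V) (a : {malg int[G]}) :
  phi (zlin h a) = zlin (fun k => phi (h k)) a.
Proof. by rewrite raddf_sum; apply: eq_bigr => k _; rewrite raddfMz. Qed.

Lemma zlin_id (G : choiceType) (a : {malg int[G]}) :
  zlin (fun k => << k >>) a = a.
Proof.
rewrite [RHS]monalgE; apply: eq_bigr => k _.
by rewrite -(raddfMz (mkmalgU k)) intz.
Qed.

(* Multinomials' ring structure on [{malg int[K]}] needs a [monomType], which
   has no nontrivial units; hence this alias with the convolution product. *)
Definition group_ring (G : groupType) : Type := {malg int[G]}.

Section GroupRing.
Variable G : groupType.

HB.instance Definition _ := GRing.Zmodule.on (group_ring G).

Definition group_ring_one : group_ring G := << 1%g >>.

Definition group_ring_mul (a b : group_ring G) : group_ring G :=
  zlin (fun x => zlin (fun y => << (x * y)%g >> : group_ring G) b) a.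

Lemma group_ring_mulA : associative group_ring_mul.
Proof.
move=> a b c; rewrite /group_ring_mul [RHS]zlin_comp.
apply: eq_zlin => x; rewrite [LHS]zlin_comp [RHS]zlin_comp.
apply: eq_zlin => y; rewrite [LHS]zlin_comp /= [RHS]zlinU.
by apply: eq_zlin => z; rewrite zlinU mulgA.
Qed.

Lemma group_ring_mul1l : left_id group_ring_one group_ring_mul.
Proof.
move=> a; rewrite /group_ring_mul zlinU -[RHS]zlin_id.
by apply: eq_zlin => y; rewrite mul1g.
Qed.

Lemma group_ring_mulr1 : right_id group_ring_one group_ring_mul.
Proof.
move=> a; rewrite /group_ring_mul -[RHS]zlin_id.
by apply: eq_zlin => x; rewrite zlinU mulg1.
Qed.

Lemma group_ring_mulDl : left_distributive group_ring_mul +%R.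
Proof. by move=> a b c; rewrite /group_ring_mul raddfD. Qed.

Lemma group_ring_mulDr : right_distributive group_ring_mul +%R.
Proof.
move=> a b c; rewrite /group_ring_mul -zlinDf.
by apply: eq_zlin => x; rewrite raddfD.
Qed.

Lemma group_ring_one_neq0 : group_ring_one != 0.
Proof. by rewrite monalgU_eq0. Qed.

HB.instance Definition _ := GRing.Zmodule_isNzRing.Build (group_ring G)
  group_ring_mulA group_ring_mul1l group_ring_mulr1
  group_ring_mulDl group_ring_mulDr group_ring_one_neq0.

End GroupRing.

Record additive_action (G : groupType) (M : zmodType) := AdditiveAction {
  aact :> G -> M -> M;
  aact1 : forall m, aact 1%g m = m;
  aactM : forall g h m, aact (g * h)%g m = aact g (aact h m);
  aactB : forall g, zmod_morphism (aact g) }.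

(* The ZG-module with underlying group [M] on which [g] acts by [A g]. *)
Definition zg_module (G : groupType) (M : zmodType) (A : additive_action G M)
  : Type := M.

Section ZGModule.
Variables (G : groupType) (M : zmodType) (A : additive_action G M).

HB.instance Definition _ := GRing.Zmodule.on (zg_module A).

HB.instance Definition _ g :=
  GRing.isZmodMorphism.Build M M (A g) (aactB A g).

Definition zg_scale (a : group_ring G) (m : zg_module A) : zg_module A :=
  zlin (fun g => A g m) a.

Lemma zg_scaleA a b m : zg_scale a (zg_scale b m) = zg_scale (a * b) m.
Proof.
rewrite /zg_scale [RHS]zlin_comp; apply: eq_zlin => x.
rewrite [LHS]zlin_comp [RHS]zlin_comp; apply: eq_zlin => y.
by rewrite /= zlinU aactM.
Qed.

Lemma zg_scale1 : left_id 1 zg_scale.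
Proof. by move=> m; rewrite /zg_scale zlinU aact1. Qed.

Lemma zg_scaleDr : right_distributive zg_scale +%R.
Proof.
move=> a m n; rewrite /zg_scale -zlinDf.
by apply: eq_zlin => x; rewrite raddfD.
Qed.

Lemma zg_scaleDl m : {morph zg_scale^~ m : a b / a + b}.
Proof. by move=> a b; rewrite /zg_scale raddfD. Qed.

HB.instance Definition _ := GRing.Zmodule_isLmodule.Build (group_ring G)
  (zg_module A) zg_scaleA zg_scale1 zg_scaleDr zg_scaleDl.

End ZGModule.

Section TrivialModule.
Variable G : groupType.

Lemma trivial_actB (g : G) : zmod_morphism (fun n : int => n).
Proof. by []. Qed.

Definition trivial_action : additive_action G int :=
  @AdditiveAction G int (fun _ n => n) (fun _ => erefl) (fun _ _ _ => erefl)
    trivial_actB.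

Definition trivial_zg_module := zg_module trivial_action.

HB.instance Definition _ := GRing.Lmodule.on trivial_zg_module.

End TrivialModule.

Definition projective (R : pzRingType) (P : lmodType R) : Prop :=
  forall (M N : lmodType R) (f : {linear M -> N}) (g : {linear P -> N}),
    (forall y : N, exists x : M, f x = y) ->
    exists h : {linear P -> M}, forall p : P, f (h p) = g p.

(* Each [g] acts by a homeomorphism: its inverse is the action of [g^-1]. *)
Record system (G : groupType) (X : topologicalType) := System {
  sact :> G -> X -> X;
  sact1 : forall x, sact 1%g x = x;
  sactM : forall g h x, sact (g * h)%g x = sact g (sact h x);
  sact_continuous : forall g, continuous (sact g) }.

Definition topologically_free (G : groupType) (X : topologicalType)
    (s : system G X) : Prop :=
  forall g : G, g <> 1%g -> dense [set x : X | s g x <> x].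

Section ContinuousIntegerFunctions.
Variable X : topologicalType.

Definition CXZ : Type := continuousType X (discrete_topology int).

HB.instance Definition _ := Choice.on CXZ.

Lemma continuous_discreteP (T : choiceType) (f : X -> discrete_topology T) :
  continuous f <-> forall x, \forall y \near x, f y = f x.
Proof.
by split=> cf x; [have /discrete_cvg := cf x | apply/discrete_cvg/cf].
Qed.

Definition CXZ_fun (f : CXZ) : X -> int := f.

Lemma CXZP (f g : CXZ) : CXZ_fun f =1 CXZ_fun g -> f = g.
Proof. by move=> e; apply/continuousEP. Qed.

Lemma CXZ_near (f : CXZ) x : \forall y \near x, CXZ_fun f y = CXZ_fun f x.
Proof. by have /continuous_discreteP := @cts_fun _ _ f; exact. Qed.

Lemma CXZ_add_continuous (f g : CXZ) :
  continuous ((fun x => CXZ_fun f x + CXZ_fun g x)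
    : X -> discrete_topology int).
Proof.
apply/continuous_discreteP => x.
by move: (CXZ_near f x) (CXZ_near g x); apply: filterS2 => y -> ->.
Qed.

Lemma CXZ_opp_continuous (f : CXZ) :
  continuous ((fun x => - CXZ_fun f x) : X -> discrete_topology int).
Proof.
apply/continuous_discreteP => x.
by move: (CXZ_near f x); apply: filterS => y ->.
Qed.

Definition CXZ_const (n : int) : CXZ := cst (n : discrete_topology int).
Definition CXZ_add (f g : CXZ) : CXZ := mkcts (@CXZ_add_continuous f g).
Definition CXZ_opp (f : CXZ) : CXZ := mkcts (@CXZ_opp_continuous f).

Lemma CXZ_addA : associative CXZ_add.
Proof. by move=> f g h; apply: CXZP => x; exact: addrA. Qed.

Lemma CXZ_addC : commutative CXZ_add.
Proof. by move=> f g; apply: CXZP => x; exact: addrC. Qed.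

Lemma CXZ_add0 : left_id (CXZ_const 0) CXZ_add.
Proof. by move=> f; apply: CXZP => x; exact: add0r. Qed.

Lemma CXZ_addN : left_inverse (CXZ_const 0) CXZ_opp CXZ_add.
Proof. by move=> f; apply: CXZP => x; exact: addNr. Qed.

HB.instance Definition _ :=
  GRing.isZmodule.Build CXZ CXZ_addA CXZ_addC CXZ_add0 CXZ_addN.

End ContinuousIntegerFunctions.

Section FunctionModule.
Variables (G : groupType) (X : topologicalType) (s : system G X).

Lemma CXZ_act_continuous (g : G) (f : CXZ X) :
  continuous ((fun x => CXZ_fun f (s g^-1%g x)) : X -> discrete_topology int).
Proof.
by move=> x; apply: continuous_comp; [exact: sact_continuous|exact: cts_fun].
Qed.

Definition CXZ_act (g : G) (f : CXZ X) : CXZ X :=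
  mkcts (@CXZ_act_continuous g f).

Lemma CXZ_act1 f : CXZ_act 1%g f = f.
Proof. by apply: CXZP => x; rewrite /CXZ_fun /= /mkcts invg1 sact1. Qed.

Lemma CXZ_actM g h f : CXZ_act (g * h)%g f = CXZ_act g (CXZ_act h f).
Proof.
by apply: CXZP => x; rewrite /CXZ_fun /= /mkcts /CXZ_fun /= /mkcts invgM sactM.
Qed.

Lemma CXZ_actB g : zmod_morphism (CXZ_act g).
Proof. by move=> f1 f2; apply: CXZP => x. Qed.

Definition CXZ_action : additive_action G (CXZ X) :=
  AdditiveAction CXZ_act1 CXZ_actM CXZ_actB.

Definition CXZ_module := zg_module CXZ_action.

HB.instance Definition _ := GRing.Lmodule.on CXZ_module.

(* An isomorphism [Z (+) P -> C(X, Z)] whose restriction to the summand [Z]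
   is the inclusion of the constant functions. *)
Definition almost_ZG_projective : Prop :=
  exists P : lmodType (group_ring G), projective P /\
  exists Phi : {linear (trivial_zg_module G * P)%type -> CXZ_module},
    bijective Phi /\ forall n : int, Phi (n, 0) = CXZ_const X n.

End FunctionModule.

Definition homeomorphism_with_inverse (X Y : topologicalType)
    (phi : X -> Y) (psi : Y -> X) : Prop :=
  [/\ continuous phi, continuous psi, cancel phi psi & cancel psi phi].

Section OrbitEquivalence.
Variables (G H : groupType) (X Y : topologicalType).
Variables (s : system G X) (t : system H Y).

Definition continuously_orbit_equivalent : Prop :=
  exists (phi : X -> Y) (psi : Y -> X)
         (a : discrete_topology G * X -> discrete_topology H)
         (b : discrete_topology H * Y -> discrete_topology G),
    [/\ homeomorphism_with_inverse phi psi,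
        continuous a,
        continuous b,
        (forall (g : G) (x : X), phi (s g x) = t (a (g, x)) (phi x)) &
        (forall (h : H) (y : Y), psi (t h y) = s (b (h, y)) (psi y))].

Definition conjugate : Prop :=
  exists (phi : X -> Y) (psi : Y -> X) (rho : {multiplicative G -> H}),
    [/\ homeomorphism_with_inverse phi psi,
        bijective rho &
        forall (g : G) (x : X), phi (s g x) = t (rho g) (phi x)].

End OrbitEquivalence.

(* Main.v *)
(* A continuous orbit equivalence gives a cocycle a : G x X -> H with
   phi (g x) = a(g, x) phi x, and each a(., x) is a bijection G -> H which
   maps adjacent elements to elements at bounded distance, so that G has at
   most one end because H does: if H is infinite, it has a central z of
   infinite order with H/<z> infinite, and an almost invariant function is
   eventually constant along <z>, with the same limit on all cosets.  Hence
   H^1(G, ZG (x) A) = 0 for all abelian groups A.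
     As C(X, Z) = Z (+) P with P projective, a dual basis of P shows that
   C(X, A)-valued cocycles (even twisted by constants) are cohomologous to
   constants.  By induction along the upper central series of H, the cocycle a
   is cohomologous to a homomorphism: u(g x) a(g, x) = rho(g) u(x).
     Then Phi x := u(x) phi(x) is rho-equivariant.  The kernel of rho is finite,
   hence trivial; topological freeness makes Phi injective.  If y is not in the
   image of Phi, then h |-> u(psi (h y)) h is an injection of H into itself of
   bounded displacement which avoids rho(G), although finitely many two-sided
   translates of rho(G) cover H; this contradicts the amenability of H. *)
Require Import Defs.
From HB Require Import structures.
From mathcomp Require Import all_boot ssralg ssrint finmap.
From mathcomp.multinomials Require Import monalg.
From mathcomp Require Import boolp classical_sets functions cardinality.
From mathcomp Require Import fsbigop topology.

Set Implicit Arguments.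
Unset Strict Implicit.
Unset Printing Implicit Defensive.

Import GRing.Theory.

Local Open Scope classical_set_scope.
Local Open Scope quotient_scope.

(** * Subgroups, the center and the central quotient *)

Section Subgroups.
Local Open Scope group_scope.
Variable G : groupType.
Implicit Types (S K : set G) (x y z : G).

Lemma subgroupM K x y : is_subgroup K -> K x -> K y -> K (x * y).
Proof.
move=> [K1 KF] Kx Ky; rewrite -[y]invgK; apply: (KF) => //.
by rewrite -[y^-1]mul1g; exact: KF.
Qed.

Lemma subgroupV K x : is_subgroup K -> K x -> K x^-1.
Proof. by move=> [K1 KF] Kx; rewrite -[x^-1]mul1g; exact: KF. Qed.

Lemma generated_is_subgroup S : is_subgroup (generated S).
Proof.
split=> [K [[]]//|x y Sx Sy K KS].
by have [[_ KF] _] := KS; apply: KF; [exact: Sx|exact: Sy].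
Qed.

Lemma sub_generated S : S `<=` generated S.
Proof. by move=> x Sx K [_]; exact. Qed.

Lemma generated_sub S K : is_subgroup K -> S `<=` K -> generated S `<=` K.
Proof. by move=> Kg SK x; exact. Qed.

Lemma generated_invariant S (P : set G) :
    generated S = [set: G] -> (forall t x, S t -> P (t * x) <-> P x) ->
  forall g x, P (g * x) <-> P x.
Proof.
move=> ST tP g.
have : generated S g by rewrite ST.
apply: (generated_sub (K := [set h | forall x, P (h * x) <-> P x])).
  split=> [x|h k /= hP kP x]; first by rewrite mul1g.
  by rewrite -mulgA hP -(kP (k^-1 * x)) mulVKg.
by move=> t St x; exact: tP.
Qed.

Lemma commutant_is_subgroup x : is_subgroup [set y | commute x y].
Proof.
split=> [|y z xy xz]; first exact: commute1.
by apply: commuteM => //; exact: commuteV.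
Qed.

Definition torsion x := exists n, (0 < n)%N /\ x ^+ n = 1.

Lemma expg_inj x : ~ torsion x -> injective (fun n => x ^+ n).
Proof.
move=> xN; suff le m n : (m <= n)%N -> x ^+ m = x ^+ n -> m = n.
  move=> m n /= e; case/orP: (leq_total m n) => mn; first exact: le.
  by apply/esym/le.
move=> mn e; apply/eqP; rewrite eqn_leq mn -subn_eq0 -leqn0 leqNgt.
apply/negP => nm; apply: xN; exists (n - m)%N; split=> //.
by rewrite expgnFr// e mulgV.
Qed.

Lemma torsionV x : torsion x^-1 -> torsion x.
Proof.
by move=> [m [m0 e]]; exists m; split=> //; rewrite -[x]invgK expVgn e invg1.
Qed.

End Subgroups.

Section Center.
Local Open Scope group_scope.
Variable H : groupType.
Implicit Types x y z : H.

Definition center : {pred H} := fun x => `[< forall y, commute x y >].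

Lemma centerP x : reflect (forall y, commute x y) (x \in center).
Proof. exact: asboolP. Qed.

Lemma center_subgroup : is_subgroup [set x | x \in center].
Proof.
split=> [|x y /centerP xC /centerP yC] /=; apply/centerP => z.
  exact/commute_sym/commute1.
by apply/commute_sym/commuteM; [|apply/commuteV]; exact/commute_sym.
Qed.

Lemma center1 : 1 \in center.
Proof. by case: center_subgroup. Qed.

Lemma centerM x y : x \in center -> y \in center -> x * y \in center.
Proof. exact: (subgroupM center_subgroup). Qed.

Lemma centerV x : x \in center -> x^-1 \in center.
Proof. exact: (subgroupV center_subgroup). Qed.

Lemma centerX x n : x \in center -> x ^+ n \in center.
Proof.
move=> xC; elim: n => [|n IHn]; first exact: center1.
by rewrite expgS centerM.
Qed.

Definition center_add (x y : {x | x \in center}) : {x | x \in center} :=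
  exist _ (sval x * sval y) (centerM (svalP x) (svalP y)).

Lemma center_addA : associative center_add.
Proof. by move=> x y z; apply: val_inj; exact: mulgA. Qed.

Lemma center_addC : commutative center_add.
Proof. by move=> x y; apply: val_inj; exact: (centerP _ (svalP x)). Qed.

Lemma center_add0 : left_id (exist _ 1 center1) center_add.
Proof. by move=> x; apply: val_inj; exact: mul1g. Qed.

Definition center_opp (x : {x | x \in center}) : {x | x \in center} :=
  exist _ (sval x)^-1 (centerV (svalP x)).

Lemma center_addN : left_inverse (exist _ 1 center1) center_opp center_add.
Proof. by move=> x; apply: val_inj; exact: mulVg. Qed.

(** The center in additive notation, so that it can serve as the coefficient group of integrals and
    of twisted cocycles. *)
Definition center_zmod : Type := {x | x \in center}.
HB.instance Definition _ := Choice.on center_zmod.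
HB.instance Definition _ := GRing.isZmodule.Build center_zmod
  center_addA center_addC center_add0 center_addN.

Definition cval (x : center_zmod) : H := sval x.

Lemma cvalD (x y : center_zmod) : cval (x + y)%R = cval x * cval y.
Proof. by []. Qed.

Lemma cvalN (x : center_zmod) : cval (- x)%R = (cval x)^-1.
Proof. by []. Qed.

Lemma cval_center (x : center_zmod) : cval x \in center.
Proof. exact: (svalP x). Qed.

Lemma cval_inj : injective cval.
Proof. exact: (@val_inj H (mem center) {x | x \in center}). Qed.

Lemma cval_surj x : x \in center -> {c | cval c = x}.
Proof. by move=> xC; exists (exist _ x xC). Qed.

Definition eq_mod_center x y : bool := x^-1 * y \in center.

Lemma eq_mod_center_refl : reflexive eq_mod_center.
Proof. by move=> x; rewrite /eq_mod_center mulVg center1. Qed.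

Lemma eq_mod_center_sym : symmetric eq_mod_center.
Proof.
move=> x y; rewrite /eq_mod_center.
by apply/idP/idP => /centerV; rewrite invgM invgK.
Qed.

Lemma eq_mod_center_trans : transitive eq_mod_center.
Proof.
by move=> y x z /centerM xy /xy; rewrite mulgA mulgK.
Qed.

Canonical eq_mod_center_rel := EquivRel eq_mod_center
  eq_mod_center_refl eq_mod_center_sym eq_mod_center_trans.

Definition central_quotient : Type := {eq_quot eq_mod_center}.
HB.instance Definition _ := Choice.on central_quotient.
HB.instance Definition _ := EqQuotient.on central_quotient.
Local Notation Q := central_quotient.

Lemma pi_center_eq x y : (\pi_Q x = \pi_Q y) <-> (x^-1 * y \in center).
Proof. by split=> [/eqmodP|e]//; exact/eqmodP. Qed.

Definition cquot_mul : Q -> Q -> Q := lift_op2 Q *%g.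
Definition cquot_inv : Q -> Q := lift_op1 Q (fun x : H => x^-1).
Definition cquot_one : Q := lift_cst Q 1.

Lemma eq_mod_centerM x x' y y' :
  x^-1 * x' \in center -> y^-1 * y' \in center ->
  (x * y)^-1 * (x' * y') \in center.
Proof.
move=> cC dC; rewrite -[x'](mulVKg x) -[y'](mulVKg y).
move: (_ * x') (_ * y') cC dC => c d cC dC.
rewrite invgM -!mulgA mulKg (mulgA c) (centerP _ cC y) -!mulgA mulKg.
exact: centerM.
Qed.

Lemma eq_mod_centerV x x' :
  x^-1 * x' \in center -> x^-1^-1 * x'^-1 \in center.
Proof.
move=> cC; rewrite -[x'](mulVKg x); move: (_ * x') cC => c cC.
by rewrite invgK invgM (centerP _ (centerV cC)) mulVKg centerV.
Qed.

Lemma pi_cquot_mul : {morph \pi_Q : x y / x * y >-> cquot_mul x y}.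
Proof.
move=> x y; unlock cquot_mul; apply/pi_center_eq.
by apply: eq_mod_centerM; apply/pi_center_eq; rewrite reprK.
Qed.

Lemma pi_cquot_inv : {morph \pi_Q : x / x^-1 >-> cquot_inv x}.
Proof.
move=> x; unlock cquot_inv; apply/pi_center_eq.
by apply: eq_mod_centerV; apply/pi_center_eq; rewrite reprK.
Qed.

Lemma cquot_mulA : associative cquot_mul.
Proof.
by elim/quotW => x; elim/quotW => y; elim/quotW => z;
  rewrite -!pi_cquot_mul mulgA.
Qed.

Lemma cquot_oneE : cquot_one = \pi_Q 1.
Proof. by unlock cquot_one. Qed.

Lemma cquot_mul1g : left_id cquot_one cquot_mul.
Proof. by elim/quotW => x; rewrite cquot_oneE -pi_cquot_mul mul1g. Qed.

Lemma cquot_mulg1 : right_id cquot_one cquot_mul.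
Proof. by elim/quotW => x; rewrite cquot_oneE -pi_cquot_mul mulg1. Qed.

Lemma cquot_mulVg : left_inverse cquot_one cquot_inv cquot_mul.
Proof.
by elim/quotW => x; rewrite -pi_cquot_inv -pi_cquot_mul mulVg cquot_oneE.
Qed.

Lemma cquot_mulgV : right_inverse cquot_one cquot_inv cquot_mul.
Proof.
by elim/quotW => x; rewrite -pi_cquot_inv -pi_cquot_mul mulgV cquot_oneE.
Qed.

HB.instance Definition _ := isGroup.Build Q cquot_mulA
  cquot_mul1g cquot_mulg1 cquot_mulVg cquot_mulgV.

Definition cproj x : Q := \pi_Q x.

Lemma cprojM x y : cproj (x * y) = cproj x * cproj y.
Proof. exact: pi_cquot_mul. Qed.

HB.instance Definition _ := isGroupMorphism.Build H Q cproj
  (fun x y => etrans (cprojM x y^-1) (congr1 _ (pi_cquot_inv y))).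

Lemma cproj_repr (q : Q) : cproj (repr q) = q.
Proof. exact: reprK. Qed.

Lemma cproj_eq x y : cproj x = cproj y <-> x^-1 * y \in center.
Proof. exact: pi_center_eq. Qed.

Lemma cproj_eq1 x : cproj x = 1 <-> x \in center.
Proof.
have -> : (1 : Q) = cproj 1 by rewrite gmulf1.
rewrite cproj_eq mulg1; split; last exact: centerV.
by move/centerV; rewrite invgK.
Qed.

End Center.

Arguments center {H}.
Arguments cproj {H}.

(** * Nilpotency through central quotients; groups with torsion center *)

Section Nilpotent.
Local Open Scope group_scope.

(** Nilpotency class read off the upper central series; the inductions below run over successive
    central quotients. *)
Fixpoint class_le (n : nat) (H : groupType) : Prop :=
  if n is m.+1 then class_le m (central_quotient H) else forall x : H, x = 1.

Lemma image_subgroup (G H : groupType) (f : UMagmaMorphism.type G H)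
  (K : set G) : is_subgroup K -> is_subgroup (f @` K).
Proof.
move=> [K1 KF]; split; first by exists 1 => //; rewrite gmulf1.
move=> _ _ [x Kx <-] [y Ky <-].
by exists (x / y); [exact: KF|rewrite gmulfF].
Qed.

Lemma preimage_subgroup (G H : groupType) (f : UMagmaMorphism.type G H)
  (K : set H) : is_subgroup K -> is_subgroup (f @^-1` K).
Proof.
move=> [K1 KF]; split; first by rewrite /preimage /= gmulf1.
by move=> x y Kx Ky; rewrite /preimage /= gmulfF; exact: KF.
Qed.

Lemma lower_central_cproj (H : groupType) n :
  @lower_central (central_quotient H) n `<=` cproj @` @lower_central H n.
Proof.
elim: n => [q _|n IHn] /=; first by exists (repr q) => //; exact: cproj_repr.
apply: generated_sub; first exact/image_subgroup/generated_is_subgroup.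
move=> _ [q [r [/IHn[x Lx <-] ->]]]; exists [~ x, repr r].
  by apply: sub_generated; exists x, (repr r).
by rewrite gmulfR /= cproj_repr.
Qed.

Lemma lower_central1 (H : groupType) n : @lower_central H n 1.
Proof. by case: n => [|n] //; exact: (generated_is_subgroup _).1. Qed.

(** If term [n.+1] of the lower central series is trivial, term [n] is central and dies in the
    central quotient, whose series is thus one step shorter. *)
Lemma lower_central_class (H : groupType) n :
  @lower_central H n = [set 1] -> class_le n H.
Proof.
elim: n H => [H /= H1 x|n IHn H Hn].
  by have : [set 1] x by rewrite -H1.
apply: IHn; apply/seteqP; split=> [q /lower_central_cproj[x Lx <-]|q ->].
  apply/cproj_eq1/centerP => y; apply/commgP/eqP.
  have : [set 1] [~ x, y] by rewrite -Hn; apply: sub_generated; exists x, y.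
  by [].
exact: lower_central1.
Qed.

Lemma generated_cproj (H : groupType) (S : set H) :
  generated S = [set: H] -> generated (cproj @` S) = setT.
Proof.
move=> ST; apply/seteqP; split=> // q _.
have : generated S (repr q) by rewrite ST.
rewrite -[q in X in _ -> X](cproj_repr q).
apply: (generated_sub (K := cproj @^-1` generated (cproj @` S))) => [|x Sx].
  exact/preimage_subgroup/generated_is_subgroup.
by apply: sub_generated; exists x.
Qed.

Lemma commute_generated (G : groupType) (S : set G) x :
  generated S = setT -> (forall t, S t -> commute x t) -> x \in center.
Proof.
move=> ST xS; apply/centerP => y; have : generated S y by rewrite ST.
by apply: (generated_sub (commutant_is_subgroup x)).
Qed.

(** Adjoining a central [m] with [m ^+ o = 1] to a finite subgroup [K] yields only the products
    [m ^+ i * k] with [i < o]. *)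
Lemma finite_generated_torsion (G : groupType) (S : set G) :
    finite_set S -> (forall x, S x -> x \in center /\ torsion x) ->
  finite_set (generated S).
Proof.
move=> /finite_seqP[s ->] sC.
suff [K [Kg Kf sK]] : exists K, [/\ is_subgroup K, finite_set K &
    [set` s] `<=` K] by apply: sub_finite_set Kf; exact: generated_sub.
elim: s sC => [_|m s IHs sC].
  exists [set 1]; split=> //; first by split=> // x y -> ->; rewrite divg1.
have [|K [Kg Kf sK]] := IHs.
  by move=> x xs; apply: sC; rewrite /= inE xs orbT.
have [/centerP mC [o [o0 mo]]] := sC m (mem_head _ _).
pose L := [set x | exists i k, K k /\ x = m ^+ i * k].
have [K1 KF] := Kg; have mX i y : commute (m ^+ i) y.
  by apply/commute_sym/commuteX/commute_sym.
(* Inverses of powers of [m] are natural powers of [m], so [L] is closed under division. *)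
have mV i : m ^- i = m ^+ (o.-1 * i).
  apply: mulg1_eq; rewrite -expgnDr -mulSn prednK//.
  by rewrite expgnA mo expg1n.
exists L; split.
- split=> [|_ _ [i [k [Kk ->]]] [j [l [Kl ->]]]].
    by exists 0, 1; rewrite expg0 mulg1.
  exists (i + o.-1 * j)%N, (k / l); split; first exact: (KF).
  rewrite invgM mV expgnDr -!mulgA; congr (_ * _).
  by rewrite [k * (l^-1 * _)]mulgA -mX mulgA.
- apply: (@sub_finite_set _ _ ((fun p => m ^+ p.1 * p.2) @` (`I_o `*` K))).
    move=> _ [i [k [Kk ->]]]; exists (i %% o, k)%N.
      by split=> //=; rewrite ltn_mod.
    by rewrite /= {2}(divn_eq i o) mulnC expgnDr expgnA mo expg1n mul1g.
  exact/finite_image/finite_setX.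
- move=> x; rewrite /= inE => /predU1P[->|xs].
    by exists 1%N, 1; rewrite expg1 mulg1.
  by exists 0, x; split; [exact: sK|rewrite expg0 mul1g].
Qed.

Lemma commute_commgX (G : groupType) (x y : G) n :
  [~ x, y] \in center -> x ^+ n * y = y * x ^+ n * [~ x, y] ^+ n.
Proof.
move=> /centerP; have := commgC x y; move: [~ x, y] => c xyc cC.
elim: n => [|n IHn]; first by rewrite !expg0 mul1g !mulg1.
rewrite !expgS -mulgA IHn !mulgA xyc -!mulgA; congr (_ * (_ * _)).
by rewrite mulgA cC -mulgA.
Qed.

Lemma common_exponent (G : groupType) (S : set G) (f : G -> G) :
    finite_set S -> (forall t, S t -> torsion (f t)) ->
  exists n, (0 < n)%N /\ forall t, S t -> f t ^+ n = 1.
Proof.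
move=> /finite_seqP[s ->]; elim: s => [_|t s IHs sT]; first by exists 1%N.
have [|n [n0 sn]] := IHs.
  by move=> u us; apply: sT; rewrite /= inE us orbT.
have [m [m0 tm]] := sT t (mem_head _ _).
exists (m * n)%N; split=> [|u]; first by rewrite muln_gt0 m0.
rewrite /= inE => /predU1P[->|us]; first by rewrite expgnA tm expg1n.
by rewrite mulnC expgnA sn// expg1n.
Qed.

(** Induction on the class. A central element of the quotient lifts to some [w] whose commutators
    with the generators are central, hence of a common exponent [m], so that [w ^+ m] is central.
    Thus the quotient is finite, and a Schreier argument then bounds the center. *)
Lemma torsion_center_finite n (H : groupType) :
    finitely_generated H -> class_le n H ->
    (forall z : H, z \in center -> torsion z) ->
  finite_set [set: H].
Proof.
elim: n H => [|n IHn] H [S [Sf ST]] Hn Ht.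
  by apply: sub_finite_set (finite_set1 1) => x _; exact: Hn.
pose Q := central_quotient H.
have Qf : finite_set [set: Q].
  apply: IHn => //.
    by exists (cproj @` S); split; [exact: finite_image|exact: generated_cproj].
  move=> q /centerP qC; rewrite -[q]cproj_repr; set w := repr q.
  have wC t : [~ w, t] \in center.
    apply/cproj_eq1; rewrite gmulfR /=; apply/eqP/commgP.
    by rewrite cproj_repr; exact: qC.
  have [m [m0 mS]] := common_exponent Sf (fun t _ => Ht _ (wC t)).
  exists m; split=> //; rewrite -gmulfXn; apply/cproj_eq1.
  apply: (commute_generated ST) => t St.
  by rewrite /commute commute_commgX// mS// mulg1.
(* [r x] is the central part of [x] relative to the section [repr]. The [nu (t, q)] with [t] in [S]
   are Schreier generators, finite in number because [S] and [Q] are finite. *)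
pose r (x : H) := (repr (cproj x))^-1 * x.
have rC x : r x \in center by apply/cproj_eq; rewrite cproj_repr.
pose nu (p : H * Q) := r (p.1 * repr p.2).
have nuE t x : r (t * x) = nu (t, cproj x) * r x.
  rewrite /nu /= /r !gmulfM /= cproj_repr -!mulgA; congr (_ * (_ * _)).
  by rewrite mulVKg.
pose M := nu @` (S `*` [set: Q]).
have Mf : finite_set (generated M).
  apply: finite_generated_torsion; first exact/finite_image/finite_setX.
  by move=> _ [p _ <-]; split; [exact: rC|exact/Ht/rC].
have [M1 MF] := generated_is_subgroup M.
have rM x : generated M (r x).
  pose x0 : H := repr (1 : Q).
  have x0M : generated M (r x0) by rewrite /r cproj_repr mulVg.
  rewrite -(mulgVK x0 x).
  apply/(@generated_invariant _ S (generated M \o r) ST) => // t {}x St /=.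
  have nuM : generated M (nu (t, cproj x)).
    by apply: sub_generated; exists (t, cproj x).
  rewrite nuE; split=> Mr; last exact: (subgroupM (generated_is_subgroup M)).
  rewrite -[r x](mulKg (nu (t, cproj x))).
  apply: (subgroupM (generated_is_subgroup M)) => //.
  exact: (subgroupV (generated_is_subgroup M)).
apply: (@sub_finite_set _ _
  ((fun p => repr p.1 * p.2) @` ([set: Q] `*` generated M))).
  by move=> x _; exists (cproj x, r x) => //=; rewrite mulVKg.
exact/finite_image/finite_setX.
Qed.
End Nilpotent.

(** * Almost invariant functions on nilpotent groups *)

Section Ends.
Local Open Scope group_scope.

(** Finiteness is joint in the index and the group element: for each [g], all but finitely many
    [F i] are exactly [g]-invariant. [I] will index a dual basis. *)
Definition almost_invariant (G : groupType) (I A : Type) (F : I -> G -> A) :=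
  forall g, finite_set [set p : I * G | F p.1 (g * p.2) <> F p.1 p.2].

Definition almost_constant (G I A : Type) (F : I -> G -> A) :=
  exists n : I -> A, finite_set [set p : I * G | F p.1 p.2 <> n p.1].

(* For a finitely generated infinite group this says that there is one end. *)
Definition almost_invariant_rigid (G : groupType) := forall (I A : Type)
  (F : I -> G -> A), almost_invariant F -> almost_constant F.

Section LimitAlongCenter.
Variables (H : groupType) (A : Type) (f : H -> A).
Hypothesis f_inv : forall g, finite_set [set k | f (g * k) <> f k].

Lemma finite_powers z k (D : set H) : ~ torsion z -> finite_set D ->
  exists N, forall n, (N <= n)%N -> ~ D (z ^+ n * k).
Proof.
move=> zN Df.
have : finite_set ((fun n => z ^+ n * k) @^-1` D).
  by apply: finite_preimage => // m n _ _ /mulIg /(expg_inj zN).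
move=> /finite_seqP[s sE]; exists (\max_(i <- s) i).+1 => n sn Dn.
have : [set` s] n by rewrite -sE.
move=> /= ns; have := @leq_bigmax_seq _ s xpredT id n ns isT.
by rewrite leqNgt sn.
Qed.

(** Almost invariance under [z] makes [f (z ^+ n)] eventually constant. As
    [z ^+ n * k = k * z ^+ n], almost invariance under [k] gives the same limit on every coset. *)
Lemma limit_along (z : H) : z \in center -> ~ torsion z ->
  exists v, forall k, exists N, forall n, (N <= n)%N -> f (z ^+ n * k) = v.
Proof.
move=> /centerP zC zN.
have [N zS] := finite_powers 1 zN (f_inv z).
exists (f (z ^+ N)) => k; have [M kS] := finite_powers 1 zN (f_inv k).
exists (maxn N M) => n; rewrite geq_max => /andP[Nn Mn].
have zk : z ^+ n * k = k * z ^+ n by apply/commute_sym/commuteX/commute_sym.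
have := kS n Mn; rewrite /= mulg1 zk => /contrapT ->.
rewrite -(subnK Nn); elim: (n - N)%N => // d IHd.
rewrite addSn expgS; have := zS (d + N)%N (leq_addl _ _).
by rewrite /= mulg1 => /contrapT ->.
Qed.

(** [f] changes along powers of [z] only at the finite set [D]. A coset of [generated [set z]] that
    misses [D] identifies the forward limit [v] with the backward limit [u]; on the cosets that meet
    [D], only finitely many values differ from [v]. *)
Lemma almost_invariant_center (z : H) : z \in center -> ~ torsion z ->
    ~ finite_index (@generated H [set z]) ->
  exists v, finite_set [set k | f k <> v].
Proof.
move=> zC zN zI; set D := [set k | f (z * k) <> f k].
have Df : finite_set D by exact: f_inv.
have [v fv] := limit_along zC zN.
have zVN : ~ torsion z^-1 by move/torsionV.
have [u fu] := limit_along (centerV zC) zVN.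
have fwd k : (forall n, ~ D (z ^+ n * k)) -> forall n, f (z ^+ n * k) = f k.
  move=> kD; elim=> [|n IHn]; first by rewrite mul1g.
  by rewrite expgS -mulgA -IHn; exact: contrapT (kD n).
have fwdv k : (forall n, ~ D (z ^+ n * k)) -> f k = v.
  by move=> kD; have [N fN] := fv k; rewrite -(fN N (leqnn _)) fwd.
(* Otherwise every coset would be that of some [d] in [D], and the index would be finite. *)
have [k0 k0D] : exists k0, forall d, D d -> ~ generated [set z] (d^-1 * k0).
  apply: contrapT => /forallNP kD; apply: zI.
  apply: sub_finite_set
    (finite_image (fun d => left_coset d (generated [set z])) Df).
  move=> _ [k _ <-]; have /existsNP[d /not_implyP[Dd /contrapT dk]] := kD k.
  have Zg := generated_is_subgroup [set z].
  exists d => //; apply/seteqP; split=> _ [x Zx <-].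
    exists ((d^-1 * k)^-1 * x); last by rewrite invgM invgK -!mulgA !mulVKg.
    by apply: (subgroupM Zg) => //; exact: (subgroupV Zg).
  exists (d^-1 * k * x); last by rewrite -!mulgA mulVKg.
  exact: (subgroupM Zg).
have Zg := generated_is_subgroup [set z].
have zX n : generated [set z] (z ^+ n).
  elim: n => [|n IHn]; first exact: Zg.1.
  by rewrite expgS; apply: (subgroupM Zg) => //; exact: sub_generated.
have k0P c : c \in center -> generated [set z] c^-1 -> ~ D (c * k0).
  move=> cC cZ /k0D; apply.
  by rewrite invgM -(centerP _ (centerV cC)) mulgVK.
have k0F n : ~ D (z ^+ n * k0).
  by apply: k0P; [exact: centerX|exact: (subgroupV Zg)].
have k0B n : ~ D (z^-1 ^+ n * k0).
  by apply: k0P; [exact/centerX/centerV|rewrite expVgn invgK].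
have uv : u = v.
  have [N fN] := fu k0; rewrite -(fN N (leqnn _)) -(fwdv _ k0F) {fN}.
  elim: N => [|N IHN]; first by rewrite mul1g.
  rewrite -IHN; apply: esym; have /contrapT := k0B N.+1.
  by rewrite expgS !mulgA mulgV mul1g.
(* A point with value other than [v] has a forward orbit that hits [D], so it is [z^-1 ^+ n * d];
   for large [n] its value would be [u = v]. *)
exists v; apply: (@sub_finite_set _ _
  (\bigcup_(d in D) [set k | (exists n, k = z^-1 ^+ n * d) /\ f k <> v])).
  move=> k /= fk; have : ~ forall n, ~ D (z ^+ n * k) by move/fwdv.
  move=> /existsNP[n /contrapT Dn]; exists (z ^+ n * k) => //; split=> //.
  by exists n; rewrite expVgn mulKg.
apply: bigcup_finite => // d _; have [N fN] := fu d.
apply: sub_finite_set (finite_image (fun n => z^-1 ^+ n * d) (finite_II N)).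
move=> k /= [[n ->] fk]; exists n => //=.
by rewrite ltnNge; apply/negP => /fN; rewrite uv.
Qed.

End LimitAlongCenter.

Lemma nilpotent_almost_invariant_rigid (H : groupType) :
    finitely_generated H -> nilpotent_group H ->
    ~ virtually_infinite_cyclic H ->
  almost_invariant_rigid H.
Proof.
move=> Hfg [c /lower_central_class Hc] HZ I A F Finv.
have Finv1 i g : finite_set [set k | F i (g * k) <> F i k].
  apply: sub_finite_set (finite_image snd (Finv g)).
  by move=> k /= Fk; exists (i, k).
have Fconst i : exists v, finite_set [set k | F i k <> v].
  have [Hf|Hf] := pselect (finite_set [set: H]).
    by exists (F i 1); exact: sub_finite_set Hf.
  have /existsNP[z /not_implyP[zC zN]] :
    ~ forall z : H, z \in center -> torsion z.
    by move/(torsion_center_finite Hfg Hc).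
  apply: (almost_invariant_center (Finv1 i) zC zN) => zI; apply: HZ.
  have Zg := generated_is_subgroup [set z].
  exists (generated [set z]); split=> //; split; last by exists z.
  move=> Zf; apply: infinite_nat.
  apply: sub_finite_set (finite_preimage (in2W (expg_inj zN)) Zf) => n _ /=.
  elim: n => [|n IHn]; first exact: Zg.1.
  by rewrite expgS; apply: (subgroupM Zg) => //; exact: sub_generated.
have [S [Sf ST]] := Hfg.
have [v vP] := choice Fconst.
pose D := \bigcup_(t in S) [set p : I * H | F p.1 (t * p.2) <> F p.1 p.2].
have Df : finite_set D by apply: bigcup_finite => // t _; exact: Finv.
(* Outside the finite set of indices occurring in [D], [F i] is invariant under the generators,
   hence constant with value [F i 1]. *)
pose n i := if `[< (fst @` D) i >] then v i else F i 1.
exists n; apply: (@sub_finite_set _ _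
  (\bigcup_(i in fst @` D) (pair i @` [set k | F i k <> v i]))).
  move=> [i k]; rewrite /= /n; case: asboolP => [Di Fk|Di []].
    by exists i => //; exists k.
  have : forall g k, F i (g * k) = F i 1 <-> F i k = F i 1.
    apply: (generated_invariant ST) => t x St.
    suff -> : F i (t * x) = F i x by [].
    by apply: contrapT => Fx; apply: Di; exists (i, x) => //; exists t.
  by move=> /(_ k 1); rewrite mulg1 => -[_]; exact.
by apply: bigcup_finite => [|i _]; exact: finite_image.
Qed.
End Ends.

(** * Amenability of nilpotent groups *)

Section Folner.
Local Open Scope fset_scope.

(** The ratio of the sizes of [F E] and [E] is below [1 + 1/m], with denominators cleared. *)
Definition folner (T : choiceType) (op : T -> T -> T) :=
  forall (F : {fset T}) m, exists2 E : {fset T}, E != fset0 &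
    (m * #|` [fset op x y | x in F, y in E]| < m.+1 * #|` E|)%N.

Lemma linear_lt_exp8 q : (5 * q <= 8 ^ q)%N.
Proof.
elim: q => // q IHq; rewrite mulnS expnS (mulnDl 1 7) mul1n addnC leq_add//.
by rewrite -[5%N]muln1 leq_mul// expn_gt0.
Qed.

Lemma polynomial_lt_exponential m r :
  exists n, (m ^ n * n.+1 ^ r < m.+1 ^ n)%N.
Proof.
case: m => [|m]; first by exists 1%N; rewrite mul0n.
(* By the first two binomial terms, [M.+1 ^ M] is at least [2 * M ^ M], so the exponent [M * k]
   gains a factor [2 ^ k]; [k] is chosen so that this beats [(M * k).+1 ^ r]. *)
set M := m.+1; pose q := (r + M)%N; pose k := (2 ^ (4 * q))%N.
exists (M * k)%N.
have le_exp a b e : (a <= b -> a ^ e <= b ^ e)%N.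
  by case: e => // e ab; rewrite leq_exp2r.
have M2 : (2 * M ^ M <= M.+1 ^ M)%N.
  rewrite -[M.+1]addn1 expnDn big_ord_recl big_ord_recl /= subn0 !exp1n !muln1.
  rewrite /bump /= bin0 bin1 mul1n addnA subn1 -expnS mul2n -addnn.
  exact: leq_addr.
have kr : ((M * k).+1 ^ r < 2 ^ k)%N.
  apply: (@leq_ltn_trans ((2 ^ (M + 4 * q)) ^ r)%N).
    apply: le_exp.
    rewrite expnD -/k; apply: (@leq_trans (M.+1 * k)%N); last first.
      by rewrite leq_mul// ltn_expl.
    by rewrite mulSn -add1n leq_add// expn_gt0.
  rewrite -expnM ltn_exp2l// /k expnM.
  apply: (@leq_ltn_trans (5 * q * q)%N).
    rewrite leq_mul ?leq_addr// (mulnDl 1 4) mul1n leq_add// leq_addl.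
    by [].
  rewrite -[(2 ^ 4)%N]/(8 * 2)%N expnMn.
  apply: (@leq_ltn_trans (8 ^ q * q)%N).
    by rewrite leq_mul ?linear_lt_exp8.
  by rewrite ltn_pmul2l ?expn_gt0// ltn_expl.
apply: (@leq_trans (M ^ (M * k) * 2 ^ k)%N).
  by rewrite ltn_pmul2l// expn_gt0.
by rewrite !expnM -expnMn mulnC; exact: le_exp.
Qed.

(** The box [E n] of combinations of [F] with coefficients at most [n] has polynomial size, and
    [F + E n] lies in [E n.+1]. If no box were a witness, the sizes would grow at least like the
    powers of [(m + 1)/m]. *)
Lemma folner_zmod (V : zmodType) : folner (fun x y : V => x + y)%R.
Proof.
move=> F m; apply: contrapT => noE; set r := size (enum_fset F).
pose s n (e : {ffun 'I_r -> 'I_n.+1}) : V :=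
  (\sum_(i < r) (enum_fset F)`_i *+ e i)%R.
pose E n := [fset s n e | e in {: {ffun 'I_r -> 'I_n.+1}}].
have E0 n : E n != fset0.
  by apply/fset0Pn; exists (s n [ffun=> ord0]); apply: in_imfset.
have En n : (#|` E n| <= n.+1 ^ r)%N.
  apply: leq_trans (leq_imfset_card _ _ _) _.
  by rewrite -cardE card_ffun !card_ord.
have ES n : (m.+1 * #|` E n| <= m * #|` E n.+1|)%N.
  apply: (@leq_trans (m * #|` [fset (x + y)%R | x in F, y in E n]|)).
    by rewrite leqNgt; apply/negP => lt; apply: noE; exists (E n).
  rewrite leq_mul// fsubset_leq_card//; apply/fsubsetP => z.
  case/imfset2P => x /= xF [y /= /imfsetP[e _ ->] ->] {y z}.
  have xr : (index x (enum_fset F) < r)%N by rewrite index_mem.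
  pose j := Ordinal xr; apply/imfsetP => /=.
  exists [ffun i => inord (e i + (i == j))] => //=.
  transitivity (\sum_(i < r) ((enum_fset F)`_i *+ e i
                              + (enum_fset F)`_i *+ (i == j)))%R; last first.
    apply: eq_bigr => i _; rewrite ffunE inordK ?mulrnDr//.
    by rewrite ltnS (leq_trans (leq_add (leqnn _) (leq_b1 _)))// addn1 ltn_ord.
  rewrite big_split /= addrC; congr (_ + _)%R.
  by rewrite (bigD1 j)//= eqxx nth_index// big1 ?addr0// => i /negPf ->.
have [n] := polynomial_lt_exponential m r.
apply/negP; rewrite -leqNgt; apply: (@leq_trans (m ^ n * #|` E n|)).
  elim: n => [|n IHn]; first by rewrite !expn0 mul1n cardfs_gt0.
  rewrite expnS; apply: (@leq_trans (m.+1 * (m ^ n * #|` E n|))%N).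
    by rewrite leq_mul2l IHn orbT.
  by rewrite mulnCA expnSr -mulnA leq_mul2l ES orbT.
by rewrite leq_mul.
Qed.

(** [E] is taken in the quotient, then [A] in the center for the finitely many cocycle values in
    [x * repr e = repr (cproj x * e) * nu x e]. The products of lifts of [E] with [A] form the
    required set. *)
Lemma folner_central_quotient (H : groupType) :
    folner (fun x y : central_quotient H => x * y)%g ->
  folner (fun x y : H => x * y)%g.
Proof.
(* With [m' = 2m + 1], the two losses combine to [(1 + 1/m')^2 < 1 + 1/m]. *)
move=> Qf F m; pose m' := m.*2.+1; pose Q := central_quotient H.
have [E E0 Em] := Qf [fset cproj x | x in F] m'.
pose nu (x : H) (e : Q) := ((repr (cproj x * e))^-1 * (x * repr e))%g.
have nuC x e : nu x e \in center.
  by apply/cproj_eq; rewrite cproj_repr gmulfM /= cproj_repr.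
pose cnu x e := sval (cval_surj (nuC x e)).
have cnuE x e : cval (cnu x e) = nu x e by exact: (svalP (cval_surj (nuC x e))).
have [A A0 Am] := folner_zmod [fset cnu x e | x in F, e in E] m'.
pose mk (p : Q * center_zmod H) : H := (repr p.1 * cval p.2)%g.
have mk_inj : injective mk.
  move=> [p c] [q d] /= e.
  have pq : p = q.
    have := congr1 cproj e; rewrite /mk !gmulfM /= !cproj_repr.
    have /cproj_eq1 -> := cval_center c; have /cproj_eq1 -> := cval_center d.
    by rewrite !mulg1.
  by move: e; rewrite /mk /= pq => /mulgI /cval_inj ->.
have cardM (B : {fset Q}) (C : {fset center_zmod H}) :
    #|` [fset mk p | p in B `*` C]| = (#|` B| * #|` C|)%N.
  rewrite card_imfset// /fsetM.
  rewrite (perm_size (enum_imfset2 _ _)) ?size_allpairs//.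
  by move=> [x y] [x' y'] _ _ /= [-> ->].
exists [fset mk p | p in E `*` A].
  by rewrite -cardfs_gt0 cardM muln_gt0 !cardfs_gt0 E0.
set FE := [fset _ | _ in _, _ in E] in Em.
set MA := [fset _ | _ in _, _ in A] in Am.
apply: (@leq_ltn_trans (m * (#|` FE| * #|` MA|))%N).
  rewrite leq_mul// -cardM fsubset_leq_card//; apply/fsubsetP => z.
  case/imfset2P => x /= xF [y /= /imfsetP[[e a] /=]].
  rewrite in_fsetM /= => /andP[eE aA] -> -> {y z}; apply/imfsetP.
  exists (cproj x * e, cnu x e + a)%g%R => /=.
    rewrite in_fsetM; apply/andP; split; apply/imfset2P.
      by exists (cproj x); [exact: in_imfset|exists e].
    by exists (cnu x e); [exact: in_imfset2|exists a].
  rewrite -[RHS]/(repr (cproj x * e) * (cval (cnu x e) * cval a))%g.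
  by rewrite cnuE /nu !mulgA mulgV mul1g.
rewrite cardM -(ltn_pmul2l (m := m' * m')%N)//.
have E1 : (0 < #|` E| * #|` A|)%N by rewrite muln_gt0 !cardfs_gt0 E0.
apply: (@leq_ltn_trans (m * (m'.+1 * m'.+1 * (#|` E| * #|` A|)))%N).
  rewrite mulnCA leq_mul// mulnACA (mulnACA m'.+1).
  by rewrite leq_mul// ltnW.
rewrite !mulnA -!(mulnA _ #|` E|) ltn_pmul2r//.
rewrite /m' (_ : m * m.*2.+2 * _ = m.*2 * m.*2.+2 * m.+1)%N; last first.
  by rewrite -doubleS -!muln2 !mulnA -!(mulnAC _ m.+1).
by rewrite ltn_pmul2r// mulnS mulSn ltn_add2r.
Qed.

Lemma folner_class_le n (H : groupType) :
  class_le n H ->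
  folner (fun x y : H => x * y)%g.
Proof.
elim: n H => [|n IHn] H Hn; last exact/folner_central_quotient/IHn.
move=> F m; exists [fset 1%g]; first by apply/fset0Pn; exists 1%g; rewrite inE.
rewrite cardfs1 muln1 ltnS -[X in (_ <= X)%N]muln1 leq_mul//.
rewrite -(cardfs1 (1%g : H)) fsubset_leq_card//; apply/fsubsetP => x _.
by rewrite inE (Hn x).
Qed.

End Folner.

(** * The dual basis of an almost projective system *)

Definition CXZ_eval (X : topologicalType) (x : X) (f : CXZ X) : int :=
  CXZ_fun f x.

Lemma CXZ_eval_zmod_morphism (X : topologicalType) (x : X) :
  zmod_morphism (CXZ_eval x).
Proof. by []. Qed.

HB.instance Definition _ (X : topologicalType) (x : X) :=
  GRing.isZmodMorphism.Build (CXZ X) int (CXZ_eval x)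
    (CXZ_eval_zmod_morphism x).

Section DualBasis.
Local Open Scope ring_scope.
Variables (G : groupType) (X : topologicalType) (s : system G X).
Local Notation R := (group_ring G).

Lemma fsum_finite_support (I : choiceType) (V : zmodType) (W : set I)
    (f : I -> V) : finite_set W -> (forall i, ~ W i -> f i = 0) ->
  \sum_(i \in [set: I]) f i = \sum_(i <- fset_set W) f i.
Proof.
move=> Wf f0; rewrite -(@fsbig_widen _ _ _ _ W) ?fsbig_finite// => i [_ Wi].
exact: f0.
Qed.

Lemma mcoeff_basis_mul (g k : G) (b : R) :
  ((<< g >> : R) * b)@_k = b@_(g^-1 * k)%g.
Proof.
rewrite -[LHS]/((group_ring_mul << g >> b)@_k) /group_ring_mul zlinU.
rewrite [LHS]zlin_comp /zlin; case: (msuppP b (g^-1 * k)%g) => [bk|bk].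
  rewrite (big_fsetD1 _ bk) /= mulVKg mcoeffUU intz big1_fset ?addr0// => h.
  rewrite !inE => /andP[hk _] _; rewrite /= mcoeffU.
  have [ghk|_] := eqVneq (g * h)%g k; last by rewrite mul0rz.
  by rewrite -ghk mulKg eqxx in hk.
rewrite big1_fset// => h hb _; rewrite /= mcoeffU.
have [ghk|_] := eqVneq (g * h)%g k; last by rewrite mul0rz.
by rewrite -ghk mulKg hb in bk.
Qed.

Section Evaluation.
Variable P : lmodType R.

(** The canonical surjection onto [P] from the free module on its underlying set; projectivity
    splits it. *)
Definition malg_eval (a : {malg R[P]}) : P := \sum_(p <- msupp a) a@_p *: p.

Lemma malg_evalEw (a : {malg R[P]}) (d : {fset P}) :
  (msupp a `<=` d)%fset -> malg_eval a = \sum_(p <- d) a@_p *: p.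
Proof.
move=> sub; apply: big_fset_incl => // p _ /mcoeff_outdom ->.
by rewrite scale0r.
Qed.

Lemma malg_eval_linear : linear malg_eval.
Proof.
move=> r a b; pose d := (msupp a `|` msupp b)%fset.
have ad : (msupp a `<=` d)%fset by exact: fsubsetUl.
have bd : (msupp b `<=` d)%fset by exact: fsubsetUr.
rewrite (malg_evalEw ad) (malg_evalEw bd) (@malg_evalEw _ d); last first.
  by apply: fsubset_trans (msuppD_le _ _) _; apply: fsetSU; exact: msuppZ_le.
rewrite scaler_sumr -big_split; apply: eq_bigr => p _ /=.
by rewrite mcoeffD mcoeffZ scalerDl scalerA.
Qed.

HB.instance Definition _ :=
  GRing.isLinear.Build R {malg R[P]} P _ malg_eval malg_eval_linear.

Lemma projective_section : projective P ->
  exists h : {linear P -> {malg R[P]}}, forall p, malg_eval (h p) = p.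
Proof.
move=> /(_ {malg R[P]} P malg_eval idfun) []; last by move=> h hK; exists h.
move=> p; exists << 1 *g p >>; rewrite /= (malg_evalEw msuppU_le).
by rewrite big_seq_fset1 mcoeffUU scale1r.
Qed.

End Evaluation.

(** A coordinate with values in the group ring is encoded by its coefficient [lam i] at the
    identity: equivariance recovers the coefficient at [g] by translating [f] by [g^-1]. [nu] is the
    projection onto the constants. *)
Definition dual_basis (I : choiceType) (nu : {additive CXZ X -> int})
    (lam : I -> {additive CXZ X -> int}) (e : I -> CXZ X) : Prop :=
  [/\ forall i n, lam i (CXZ_const X n) = 0,
      forall f,
        finite_set [set p : I * G | lam p.1 (CXZ_act s p.2^-1%g f) <> 0] &
      forall f x, CXZ_fun f x = nu f + \sum_(p \in [set: I * G])
        lam p.1 (CXZ_act s p.2^-1%g f) * CXZ_fun (e p.1) (s p.2^-1%g x)].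

Lemma almost_projective_dual_basis : almost_ZG_projective s ->
  exists (I : choiceType) nu (lam : I -> _) e, dual_basis nu lam e.
Proof.
move=> [P [/projective_section[h hK] [Phi [[Psi PhiK PsiK] Phi1]]]].
have PsiB : zmod_morphism Psi by exact: (can2_zmod_morphism PhiK PsiK).
have PsiZ r f : Psi (r *: f) = r *: Psi f.
  by apply: (can_inj PhiK); rewrite linearZ !PsiK.
pose c f : {malg R[P]} := h (Psi f).2.
have cB f f' : c (f - f') = c f - c f' by rewrite /c PsiB /= raddfB.
have cJ g f : c (CXZ_act s g f) = (<< g >> : R) *: c f.
  have -> : CXZ_act s g f = (<< g >> : R) *: (f : CXZ_module s).
    by rewrite /GRing.scale /= /zg_scale zlinU.
  by rewrite /c PsiZ /= linearZ.
have lam_add (p : P) : zmod_morphism (fun f : CXZ X => (c f)@_p@_1%g : int).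
  by move=> f f'; rewrite cB !mcoeffB.
have nu_add : zmod_morphism (fun f : CXZ X => (Psi f).1 : int).
  by move=> f f'; rewrite PsiB.
have [lam lam1] : exists lam : P -> {additive CXZ X -> int},
    forall p f, lam p f = (c f)@_p@_1%g.
  pose lam p : {additive CXZ X -> int} :=
    HB.pack (fun f : CXZ X => (c f)@_p@_1%g : int)
      (GRing.isZmodMorphism.Build _ _ _ (lam_add p)).
  by exists lam.
have [nu nuE] : exists nu : {additive CXZ X -> int}, forall f, nu f = (Psi f).1.
  pose nu : {additive CXZ X -> int} :=
    HB.pack (fun f : CXZ X => (Psi f).1 : int)
      (GRing.isZmodMorphism.Build _ _ _ nu_add).
  by exists nu.
have lamE f p g : lam p (CXZ_act s g^-1%g f) = (c f)@_p@_g.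
  by rewrite lam1 cJ mcoeffZ mcoeff_basis_mul invgK mulg1.
exists P, nu, lam, (fun p => Phi (0, p)); split.
- by move=> p n; rewrite lam1 /c -Phi1 PhiK /= raddf0 !mcoeff0.
- move=> f; apply: (@sub_finite_set _ _
    [set` [seq (p, g) | p <- msupp (c f), g <- msupp (c f)@_p]]).
    move=> [p g] cpg; have {}cpg : (c f)@_p@_g <> 0 by rewrite -lamE.
    apply/allpairsPdep; exists p, g; split=> //; rewrite -mcoeff_neq0.
      by apply/eqP => cp; apply: cpg; rewrite cp mcoeff0.
    exact/eqP.
  exact: finite_seq.
move=> f x.
pose r := [seq (p, g) | p <- msupp (c f), g <- msupp (c f)@_p].
have r_uniq : uniq r.
  by apply: allpairs_uniq_dep => // -[p g] [p' g'] _ _ /= [-> ->].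
rewrite -(@fsbig_widen _ _ _ _ [set` r]) //; last first.
  move=> [p g] [_ rpg]; rewrite /preimage /= lamE.
  have [->|cpg] := eqVneq ((c f)@_p@_g) 0; first by rewrite mul0r.
  exfalso; apply: rpg; apply/allpairsPdep; exists p, g.
  split=> //; rewrite -mcoeff_neq0//.
  by apply: contraNneq cpg => ->; rewrite mcoeff0.
rewrite -fsbig_seq// big_allpairs_dep /=.
have Phi2B : zmod_morphism (fun p : P => Phi (0, p) : CXZ X).
  by move=> p q; rewrite -raddfB; congr (Phi (_, _)); rewrite subr0.
pose Phi2 : {additive P -> CXZ X} := HB.pack (fun p : P => Phi (0, p) : CXZ X)
  (GRing.isZmodMorphism.Build _ _ _ Phi2B).
have Phi2Z (a : R) p : Phi2 (a *: p) = zlin (fun g => CXZ_act s g (Phi2 p)) a.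
  rewrite -[RHS]/(a *: (Phi (0, p) : CXZ_module s)) -linearZ.
  by rewrite /Phi2 /=; congr (Phi (_, _)); rewrite scaler0.
have fE : f = CXZ_const X (Psi f).1 + Phi2 (malg_eval (c f)).
  transitivity (Phi (((Psi f).1, 0) + (0, (Psi f).2))).
    rewrite -[LHS]PsiK; congr (Phi _).
    by case: (Psi f) => n p; congr (_, _); rewrite ?addr0 ?add0r.
  by rewrite hK -Phi1; exact: raddfD.
transitivity (CXZ_eval x (CXZ_const X (Psi f).1 + Phi2 (malg_eval (c f)))).
  exact: (congr1 (CXZ_eval x) fE).
rewrite nuE [LHS]raddfD; congr (_ + _); rewrite /malg_eval !raddf_sum.
apply: eq_bigr => p _; rewrite Phi2Z [LHS]zlin_comp; apply: eq_bigr => g _.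
by rewrite lamE mulrC -mulrzz.
Qed.

End DualBasis.

(** * Integration against additive functionals on C(X, Z) *)

Section LocallyConstant.
Variable X : topologicalType.

(** Continuity into the discrete space [T], stated without putting a topology on [T]. *)
Definition lconst (T : Type) (f : X -> T) :=
  forall x, \forall y \near x, f y = f x.

Lemma lconst_comp (T U : Type) (h : T -> U) (f : X -> T) :
  lconst f -> lconst (h \o f).
Proof. by move=> fl x; apply: filterS (fl x) => y /= ->. Qed.

Lemma lconst_pair (T U : Type) (f : X -> T) (g : X -> U) :
  lconst f -> lconst g -> lconst (fun x => (f x, g x)).
Proof. by move=> fl gl x; apply: filterS2 (fl x) (gl x) => y -> ->. Qed.

Lemma lconst_cst (T : Type) (c : T) : lconst (fun=> c).
Proof. by move=> x; exact: nearW. Qed.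

Lemma lconst_continuous (T : Type) (f : X -> T) (g : X -> X) :
  continuous g -> lconst f -> lconst (f \o g).
Proof. by move=> gc fl x; exact: (gc x _ (fl (g x))). Qed.

Lemma lconst_finite (T : Type) (f : X -> T) :
  compact [set: X] -> lconst f -> finite_set (range f).
Proof.
move=> /compact_near_coveringP Xc fl.
(* The filter of properties true of all sufficiently large sets of values. Near each [x] the set
   [[set f x]] suffices, so compactness provides one finite set for all of [X]. *)
pose F (B : set (set T)) :=
  exists2 A : set T, finite_set A & forall S, A `<=` S -> B S.
have Ff : Filter F.
  split=> [|B C [A Af AB] [A' Af' AC]|B C BC [A Af AB]].
  - by exists set0.
  - exists (A `|` A'); first by rewrite finite_setU.
    by move=> S; rewrite subUset => -[AS AS2]; split; [exact: AB|exact: AC].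
  - by exists A => // S /AB /BC.
have [|A Af AX] := Xc _ F (fun S x => S (f x)) Ff.
  move=> x _; exists ([set y | f y = f x], [set S | S (f x)]).
    split; first exact: fl.
    by exists [set f x]; [exact: finite_set1|move=> S; exact].
  by move=> [y S] /= [->].
by apply: sub_finite_set Af => _ [x _ <-]; exact: AX.
Qed.

End LocallyConstant.

Section Integral.
Local Open Scope ring_scope.
Variable X : topologicalType.
Hypothesis X_compact : compact [set: X].

Lemma lconst_CXZ (f : X -> int) : lconst f ->
  continuous (f : X -> discrete_topology int).
Proof. by move=> fl; apply/continuous_discreteP. Qed.

(** The default [0] is used when the level set is not clopen. *)
Definition indicator (T : Type) (f : X -> T) (a : T) : CXZ X :=
  if pselect (lconst (fun x => (`[< f x = a >] : nat)%:Z)) is left fl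
  then mkcts (lconst_CXZ fl) else 0.

Lemma indicatorE (T : Type) (f : X -> T) (a : T) x :
  lconst f -> CXZ_fun (indicator f a) x = (`[< f x = a >] : nat)%:Z.
Proof.
rewrite /indicator => fl; case: pselect => // -[].
exact: (lconst_comp (fun t => (`[< t = a >] : nat)%:Z) fl).
Qed.

Section Additive.
Variables (V : zmodType) (mu : {additive CXZ X -> int}).

(** On locally constant functions on the compact [X], this is [mu] tensored with the identity of
    [V]. *)
Definition integral (f : X -> V) : V :=
  \sum_(a \in range f) a *~ mu (indicator f a).

(** The levels of [h] refine those of [F \o h], and [mu] is additive on the indicators. Additivity
    of the integral follows by taking for [h] a pair of functions. *)
Lemma integral_comp (T : choiceType) (h : X -> T) (F : T -> V) : lconst h ->
  integral (F \o h) = \sum_(d \in range h) F d *~ mu (indicator h d).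
Proof.
move=> hl; have hf := lconst_finite X_compact hl.
have Fhl := lconst_comp F hl; have Fhf := lconst_finite X_compact Fhl.
rewrite /integral !fsbig_finite//.
have ind a : mu (indicator (F \o h) a) = \sum_(d <- fset_set (range h))
    mu (indicator h d) *+ `[< F d = a >].
  under eq_bigr do rewrite -raddfMn.
  rewrite -raddf_sum; congr (mu _); apply: CXZP => x.
  rewrite -[RHS]/(CXZ_eval x _) raddf_sum (big_fsetD1 (h x)) /=; last first.
    by rewrite in_fset_set//; apply: mem_set; exists x.
  rewrite raddfMn big1_fset ?addr0 => [|d]; last first.
    rewrite !inE => /andP[/eqP dh _] _.
    rewrite raddfMn /= /CXZ_eval indicatorE//.
    by rewrite asboolF ?mul0rn// => hd; apply: dh.
  rewrite indicatorE//= /CXZ_eval indicatorE// (asboolT (erefl (h x))).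
  by case: asboolP.
under eq_bigr do rewrite ind.
under eq_bigr do rewrite raddf_sum.
rewrite exchange_big /= big_seq [RHS]big_seq; apply: eq_bigr => d.
rewrite in_fset_set// inE => -[x _ hx].
rewrite (big_fsetD1 (F d)) /=; last first.
  by rewrite in_fset_set//; apply: mem_set; exists x; rewrite //= hx.
rewrite asboolT// mulr1n big1_fset ?addr0// => a.
rewrite !inE => /andP[/eqP aF _] _.
by rewrite asboolF ?mulr0n ?mulr0z// => /esym.
Qed.

Lemma integralD (f g : X -> V) : lconst f -> lconst g ->
  integral (fun x => f x + g x) = integral f + integral g.
Proof.
move=> fl gl; have pl := lconst_pair fl gl.
rewrite (integral_comp (fun p => p.1 + p.2) pl) (integral_comp fst pl).
rewrite (integral_comp snd pl) -fsbig_split; last exact: lconst_finite.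
by apply: eq_fsbigr => p _; rewrite /= mulrzDl.
Qed.

Lemma integral_cst (c : V) :
  (forall n, mu (CXZ_const X n) = 0) -> integral (fun=> c) = 0.
Proof.
move=> mu0; apply: fsbig1 => a _; suff -> : indicator (fun=> c) a =
  CXZ_const X (`[< c = a >] : nat)%:Z by rewrite mu0 mulr0z.
by apply: CXZP => x; rewrite indicatorE//; exact: lconst_cst.
Qed.

End Additive.

Variables (G : groupType) (s : system G X).

Lemma indicator_act (T : Type) (f : X -> T) (a : T) k : lconst f ->
  indicator (f \o s k) a = CXZ_act s k^-1%g (indicator f a).
Proof.
move=> fl; apply: CXZP => x; rewrite indicatorE.
  rewrite -[RHS]/(CXZ_fun (indicator f a) (s k^-1^-1%g x)).
  by rewrite indicatorE// invgK.
exact: lconst_continuous (@sact_continuous _ _ s k) fl.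
Qed.

Lemma range_act (T : Type) (f : X -> T) k : range (f \o s k) = range f.
Proof.
apply/seteqP; split=> _ [x _ <-]; first by exists (s k x).
by exists (s k^-1%g x) => //=; rewrite -sactM mulgV sact1.
Qed.

Variables (I : choiceType) (nu : {additive CXZ X -> int}).
Variables (lam : I -> {additive CXZ X -> int}) (e : I -> CXZ X).
Hypothesis basis : dual_basis s nu lam e.
Variable V : zmodType.
Implicit Types f : X -> V.

Let supp (f : CXZ X) : set (I * G) :=
  [set p | lam p.1 (CXZ_act s p.2^-1%g f) <> 0].

Lemma integral_translate f i k : lconst f -> integral (lam i) (f \o s k) =
  \sum_(a \in range f) a *~ lam i (CXZ_act s k^-1%g (indicator f a)).
Proof.
move=> fl; rewrite /integral range_act; apply: eq_fsbigr => a _.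
by rewrite indicator_act.
Qed.

Lemma integral_translate_finite f : lconst f ->
  finite_set [set p : I * G | integral (lam p.1) (f \o s p.2) <> 0].
Proof.
move=> fl; have [_ suppf _] := basis.
apply: (@sub_finite_set _ _ (\bigcup_(a in range f) supp (indicator f a))).
  move=> [i k] /=; rewrite integral_translate// => f0; apply: contrapT => fN.
  apply: f0; apply: fsbig1 => a fa; have [->|li] := pselect
    (lam i (CXZ_act s k^-1%g (indicator f a)) = 0); first by rewrite mulr0z.
  by case: fN; exists a.
by apply: bigcup_finite => [|a _]; [exact: lconst_finite|exact: suppf].
Qed.

(** [f] is the sum of its finitely many values times indicators; each indicator is expanded in the
    dual basis and the finite sums are exchanged. *)
Lemma integral_expand f x : lconst f ->
  f x = integral nu f + \sum_(p \in [set: I * G])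
    integral (lam p.1) (f \o s p.2) *~ CXZ_fun (e p.1) (s p.2^-1%g x).
Proof.
move=> fl; have [_ suppf dual] := basis.
have ff := lconst_finite X_compact fl.
pose W := \bigcup_(a in range f) supp (indicator f a).
have Wf : finite_set W by apply: bigcup_finite => // a _; exact: suppf.
have W0 p a : range f a -> ~ W p ->
    lam p.1 (CXZ_act s p.2^-1%g (indicator f a)) = 0.
  by move=> fa pW; apply: contrapT => la; apply: pW; exists a.
rewrite (fsum_finite_support Wf); last first.
  move=> p pW; rewrite integral_translate// fsbig1 ?mul0rz// => a fa.
  by rewrite W0// mulr0z.
under eq_bigr do rewrite integral_translate// fsbig_finite// mulrz_suml.
rewrite exchange_big /= /integral fsbig_finite// -big_split /=.
rewrite (big_fsetD1 (f x)) /=; last first.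
  by rewrite in_fset_set//; apply: mem_set; exists x.
have term a : range f a -> a *~ nu (indicator f a) +
    \sum_(p <- fset_set W)
      a *~ lam p.1 (CXZ_act s p.2^-1%g (indicator f a)) *~
        CXZ_fun (e p.1) (s p.2^-1%g x) = a *~ CXZ_fun (indicator f a) x.
  move=> fa; rewrite dual mulrzDr; congr (_ + _).
  rewrite (fsum_finite_support Wf) => [|p pW]; last by rewrite W0// mul0r.
  by rewrite raddf_sum; apply: eq_bigr => p _; rewrite -mulrzA.
rewrite term; last by exists x.
rewrite indicatorE// asboolT// mulr1z big1_fset ?addr0// => a.
rewrite !inE => /andP[/eqP afx]; rewrite in_fset_set// => /set_mem fa _.
by rewrite term// indicatorE// asboolF ?mulr0z// => /esym.
Qed.

End Integral.

(** * Cocycle rigidity *)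

Section CocycleRigidity.
Local Open Scope ring_scope.
Variables (G : groupType) (X : topologicalType) (s : system G X).
Hypothesis X_compact : compact [set: X].
Hypothesis G_rigid : almost_invariant_rigid G.
Hypothesis s_projective : almost_ZG_projective s.

Lemma lconst_sum (V : zmodType) (J : Type) (r : seq J) (F : J -> X -> V) :
  (forall j, lconst (F j)) -> lconst (fun x => \sum_(j <- r) F j x).
Proof.
move=> Fl x; elim: r => [|j r IHr].
  by apply: nearW => y; rewrite !big_nil.
by apply: filterS2 (Fl j x) IHr => y Fj Fr; rewrite !big_cons Fj Fr.
Qed.

Lemma fsumB_finite (J : choiceType) (V : zmodType) (W W' : set J)
    (f g : J -> V) : finite_set W -> finite_set W' ->
    (forall i, ~ W i -> f i = 0) -> (forall i, ~ W' i -> g i = 0) ->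
  \sum_(i \in [set: J]) (f i - g i) =
  \sum_(i \in [set: J]) f i - \sum_(i \in [set: J]) g i.
Proof.
move=> Wf Wf' f0 g0; have Uf : finite_set (W `|` W') by rewrite finite_setU.
have f0U i : ~ (W `|` W') i -> f i = 0
  by move=> U; apply: f0 => Wi; apply: U; left.
have g0U i : ~ (W `|` W') i -> g i = 0
  by move=> U; apply: g0 => Wi; apply: U; right.
rewrite !(fsum_finite_support Uf) ?sumrB// => i Ui.
by rewrite f0U// g0U// subr0.
Qed.

(* The coefficients F i k of c k in the dual basis satisfy
   F i (g * k) - F i k = (coefficient of c g translated by k), which vanishes
   for almost all (i, k); after subtraction of constants n i, F has finite
   support and is the coefficient family of the transfer function. *)
Lemma twisted_cocycle_trivial (V : zmodType) (c : G -> X -> V)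
    (omega : G -> G -> V) :
    (forall g, lconst (c g)) ->
    (forall g k x, c (g * k)%g x = omega g k + c g (s k x) + c k x) ->
  exists (tau : G -> V) (w : X -> V), lconst w /\
    forall g x, c g x = tau g + w (s g x) - w x.
Proof.
move=> cl cM.
have [I [nu [lam [e basis]]]] := almost_projective_dual_basis s_projective.
have [lam1 _ _] := basis.
pose F i k := integral (lam i) (c k).
have cTl g k : lconst (c g \o s k).
  exact: lconst_continuous (@sact_continuous _ _ s k) (cl g).
have FM i g k : F i (g * k)%g - F i k = integral (lam i) (c g \o s k).
  rewrite /F; have -> : c (g * k)%g = fun x => omega g k + c g (s k x) + c k x.
    by apply/funext => x; exact: cM.
  have omega_l : lconst (fun _ : X => omega g k) by exact: lconst_cst.
  rewrite (integralD X_compact _ _ (cl k)); last first.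
    by move=> x; apply: filterS (cTl g k x) => y /= ->.
  rewrite addrK (integralD X_compact _ omega_l (cTl g k)).
  by rewrite integral_cst// add0r.
have [|n Fn] := @G_rigid I V F.
  move=> g; apply: sub_finite_set
    (integral_translate_finite X_compact basis (cl g)).
  by move=> [i k] /=; rewrite -FM => Fgk; move/eqP; rewrite subr_eq0 => /eqP.
pose F' (p : I * G) := F p.1 p.2 - n p.1.
set W := [set p | _] in Fn.
have F'0 p : ~ W p -> F' p = 0 by move=> /contrapT Fp; rewrite /F' Fp subrr.
pose w x := \sum_(p \in [set: I * G]) F' p *~ CXZ_fun (e p.1) (s p.2^-1%g x).
have wE x : w x = \sum_(p <- fset_set W) F' p *~ CXZ_fun (e p.1) (s p.2^-1%g x).
  by rewrite /w (fsum_finite_support Fn)// => p /F'0 ->; rewrite mul0rz.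
have wl : lconst w.
  suff -> : w = fun x => \sum_(p <- fset_set W)
      F' p *~ CXZ_fun (e p.1) (s p.2^-1%g x).
    apply: lconst_sum => p; apply: (lconst_comp (fun m => F' p *~ m)).
    apply: (lconst_continuous (@sact_continuous _ _ s _)).
    exact: CXZ_near.
  exact/funext.
exists (fun g => integral nu (c g)), w; split=> // g x.
rewrite (integral_expand X_compact basis x (cl g)) -addrA; congr (_ + _).
(* After this reindexing, [w (s g x) - w x] has the coefficients [F i (g * k) - F i k], from which
   the constants [n i] have cancelled. *)
pose shift (p : I * G) := (p.1, g * p.2)%g.
have shift_bij : bijective shift.
  exists (fun p : I * G => (p.1, g^-1 * p.2)%g) => -[i k] /=.
    by rewrite /shift /= mulKg.
  by rewrite /shift /= mulVKg.
have -> : w (s g x) = \sum_(p \in [set: I * G])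
    F' (shift p) *~ CXZ_fun (e p.1) (s p.2^-1%g x).
  rewrite /w (reindex_fsbigT _ _ shift_bij); apply: eq_fsbigr => p _ /=.
  by rewrite -sactM invgM mulgVK.
rewrite -(@fsumB_finite _ _ (shift @^-1` W) W)//.
- apply: eq_fsbigr => -[i k] _ /=; rewrite -FM -mulrzBl /F' /=.
  by congr (_ *~ _); rewrite opprB addrA subrK.
- apply: finite_preimage => // p q _ _; exact: bij_inj.
- by move=> p /F'0 ->; rewrite mul0rz.
- by move=> p /F'0 ->; rewrite mul0rz.
Qed.

Local Open Scope group_scope.

(** Induction on the class: a solution for the central quotient is lifted to [u0] and [sigma]. The
    transformed cocycle [a'] is then [sigma] times a central-valued [c], which is a cocycle twisted
    by the defect [omega] of [sigma]. *)
Lemma cocycle_rigidity n (H : groupType) (a : G -> X -> H) : class_le n H ->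
    (forall g, lconst (a g)) ->
    (forall g k x, a (g * k) x = a g (s k x) * a k x) ->
  exists (u : X -> H) (rho : G -> H), lconst u /\
    forall g x, u (s g x) * a g x = rho g * u x.
Proof.
elim: n H a => [|n IHn] H a Hn al aM.
  exists (fun=> 1), (fun=> 1); split=> [|g x]; first exact: lconst_cst.
  by rewrite !(Hn (_ * _)).
have [[x0 _]|X0] := pselect (exists x : X, True); last first.
  exists (fun=> 1), (fun=> 1); split; first exact: lconst_cst.
  by move=> g x; case: X0; exists x.
have [|g k x|u' [rho' [u'l uE]]] := IHn _ (fun g => cproj \o a g) Hn.
- by move=> g; exact: lconst_comp.
- by rewrite /= aM gmulfM.
pose u0 x : H := repr (u' x); pose sigma g : H := repr (rho' g).
have u0l : lconst u0 by exact: lconst_comp.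
pose a' g x := u0 (s g x) * a g x * (u0 x)^-1.
have a'M g k x : a' (g * k) x = a' g (s k x) * a' k x.
  by rewrite /a' aM sactM !mulgA mulgVK.
have a'C g x : (sigma g)^-1 * a' g x \in center.
  apply/cproj_eq; rewrite cproj_repr !gmulfM gmulfV /= !cproj_repr.
  by rewrite uE mulgK.
pose c g x := sval (cval_surj (a'C g x)).
have cE g x : cval (c g x) = (sigma g)^-1 * a' g x.
  exact: (svalP (cval_surj (a'C g x))).
have a'E g x : a' g x = sigma g * cval (c g x) by rewrite cE mulVKg.
have cC g x y : commute (cval (c g x)) y by exact: (centerP _ (cval_center _)).
pose omega g k := (sigma (g * k))^-1 * sigma g * sigma k.
have cM g k x : cval (c (g * k) x) =
    omega g k * (cval (c g (s k x)) * cval (c k x)).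
  rewrite cE a'M !a'E /omega -!mulgA; congr (_ * (_ * _)).
  by rewrite mulgA (cC g (s k x) (sigma k)) -mulgA.
(* Evaluation at [x0] writes [omega] as a quotient of central elements. *)
have omegaC g k : omega g k \in center.
  have -> : omega g k =
      cval (c (g * k) x0) / (cval (c g (s k x0)) * cval (c k x0)).
    by rewrite cM mulgK.
  by rewrite centerM ?centerV ?centerM// cval_center.
pose omegaZ g k := sval (cval_surj (omegaC g k)).
have omegaE g k : cval (omegaZ g k) = omega g k.
  exact: (svalP (cval_surj (omegaC g k))).
have cl g : lconst (c g).
  move=> x; have a'l : lconst (a' g).
    apply: (lconst_comp (fun p => p.1 * p.2.1 * p.2.2^-1)
      (lconst_pair _ (lconst_pair (al g) u0l))).
    exact: lconst_continuous (@sact_continuous _ _ s g) u0l.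
  by apply: filterS (a'l x) => y a'y; apply: cval_inj; rewrite !cE a'y.
have [|tau [w [wl cw]]] := twisted_cocycle_trivial (omega := omegaZ) cl.
  by move=> g k x; apply: cval_inj; rewrite !cvalD omegaE cM mulgA.
exists (fun x => (cval (w x))^-1 * u0 x), (fun g => sigma g * cval (tau g)).
split=> [|g x].
  exact: (lconst_comp (fun p => (cval p.1)^-1 * p.2) (lconst_pair wl u0l)).
have u0E : u0 (s g x) * a g x = a' g x * u0 x by rewrite /a' mulgVK.
apply: (mulgI (cval (w (s g x)))).
rewrite -mulgA mulVKg u0E a'E cw !cvalD cvalN [RHS]mulgA.
by rewrite (centerP _ (cval_center (w (s g x)))) -!mulgA.
Qed.

End CocycleRigidity.

(** * Orbit equivalence *)

Section OrbitEquivalenceCocycle.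
Local Open Scope group_scope.

(** [h^-1 * k] fixes a nonempty open set pointwise, whereas a nontrivial element moves a dense set
    of points. *)
Lemma free_act_eq (H : groupType) (Y : topologicalType) (t : system H Y)
    (h k : H) (y : Y) : topologically_free t ->
  (\forall y' \near y, t h y' = t k y') -> h = k.
Proof.
move=> tf hk; apply: contrapT => hNk.
have /(tf _) : h^-1 * k <> 1 by move=> /mulg1_eq; rewrite invgK.
have : nbhs y (fun y' => t h y' = t k y') := hk.
rewrite nbhsE => -[U [Uo Uy] UP] /(_ U) [|//|z [Uz]]; first by exists y.
by apply; rewrite sactM -UP// -sactM mulVg sact1.
Qed.

Lemma lconst_cocycle (G H : groupType) (X : topologicalType)
    (a : discrete_topology G * X -> discrete_topology H) :
  continuous a -> forall g, lconst (fun x => a (g, x) : H).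
Proof.
move=> ac g x; have /discrete_cvg := ac (g, x).
move=> [[A B] [/= gA xB] AB]; apply: filterS xB => x' Bx'.
by apply: (AB (g, x')); split=> //=; exact: nbhs_singleton gA.
Qed.

(* One half of an orbit equivalence; the inverse orbit equivalence
   satisfies the same hypotheses with the roles exchanged. *)
Section Half.
Variables (G H : groupType) (X Y : topologicalType).
Variables (s : system G X) (t : system H Y) (phi : X -> Y) (psi : Y -> X).
Variables (a : G -> X -> H) (b : H -> Y -> G).
Hypotheses (psi_c : continuous psi).
Hypotheses (phiK : cancel phi psi) (psiK : cancel psi phi).
Hypotheses (al : forall g, lconst (a g)) (bl : forall h, lconst (b h)).
Hypothesis phiE : forall g x, phi (s g x) = t (a g x) (phi x).
Hypothesis psiE : forall h y, psi (t h y) = s (b h y) (psi y).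

Lemma near_psi (P : X -> Prop) (x : X) :
  (\forall x' \near x, P x') -> \forall y \near phi x, P (psi y).
Proof. by move=> Px; apply: psi_c; rewrite phiK. Qed.

Lemma free_phi_eq (h k : H) (x : X) : topologically_free t ->
  (\forall x' \near x, t h (phi x') = t k (phi x')) -> h = k.
Proof.
move=> tf hk; apply: (free_act_eq (y := phi x) tf).
have := @near_psi (fun x' => t h (phi x') = t k (phi x')) x hk.
by apply: filterS => y; rewrite psiK.
Qed.

(** Both sides carry [phi x'] to [phi (s (g * k) x')] for all [x'] near [x], so topological freeness
    identifies them. *)
Lemma orbit_cocycleM : topologically_free t ->
  forall g k x, a (g * k) x = a g (s k x) * a k x.
Proof.
move=> tf g k x; apply: (free_phi_eq (x := x) tf).
have := lconst_continuous (@sact_continuous _ _ s k) (al g).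
move=> /(_ x); move: (al (g * k) x) (al k x); apply: filterS3 => x' agk ak ag.
by rewrite -agk -phiE sactM phiE phiE -ak sactM -[a g (s k x)]ag.
Qed.

Lemma orbit_cocycleK : topologically_free s -> continuous phi ->
  forall g x, b (a g x) (phi x) = g.
Proof.
move=> sf phic g x; apply: (free_act_eq (y := x) sf).
have bpl : \forall x' \near x, b (a g x) (phi x') = b (a g x) (phi x).
  exact: (phic x _ (bl (a g x) (phi x))).
move: (al g x) bpl; apply: filterS2 => x' ag bg.
by have := psiE (a g x') (phi x'); rewrite -phiE !phiK -bg -ag.
Qed.

End Half.

(** Functions on [G] are pulled back along the bijection [b^~ y]. By the cocycle identity,
    translation by [h] becomes translation by one of the finitely many values of [b h], so almost
    invariance is preserved. *)
Lemma orbit_equivalence_rigid (G H : groupType) (X Y : topologicalType)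
    (a : G -> X -> H) (b : H -> Y -> G) (t : system H Y) (x : X) (y : Y) :
    compact [set: Y] -> (forall h, lconst (b h)) ->
    (forall g, b (a g x) y = g) -> (forall h, a (b h y) x = h) ->
    (forall h k y, b (h * k) y = b h (t k y) * b k y) ->
  almost_invariant_rigid H -> almost_invariant_rigid G.
Proof.
move=> Yc bl baK abK bM Hr I A F Finv.
have bK : injective (fun p : I * H => (p.1, b p.2 y)).
  by move=> [i h] [j k] /= [-> /(congr1 (a^~ x))]; rewrite !abK => ->.
have [|n nF] := Hr I A (fun i h => F i (b h y)).
  move=> h; have bf := lconst_finite Yc (bl h).
  have : finite_set (\bigcup_(g in range (b h))
      [set p : I * G | F p.1 (g * p.2) <> F p.1 p.2]).
    by apply: bigcup_finite => // g _; exact: Finv.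
  move=> /(finite_preimage (in2W bK)); apply: sub_finite_set => -[i k] /= Fk.
  by exists (b h (t k y)); [exists (t k y)|rewrite /= -bM].
exists n; apply: (sub_finite_set _
  (finite_image (fun p : I * H => (p.1, b p.2 y)) nF)).
by move=> [i g] /= Fg; exists (i, a g x); rewrite /= baK.
Qed.

End OrbitEquivalenceCocycle.

(** * From a cocycle cohomologous to a homomorphism to a conjugacy *)

Section Conjugacy.
Local Open Scope group_scope.

(* The displacement R moves a Folner set only a little, while a translate of
   the set meets L in a proportion at least 1/|R|^2 which theta avoids. *)
Lemma folner_displacement (H : groupType) (L : set H) (R : {fset H})
    (theta : H -> H) : folner (fun x y : H => x * y) -> injective theta ->
    (forall h, exists2 r, r \in R & theta h = r * h) ->
    (forall h, ~ L (theta h)) ->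
    (forall h, exists r r', [/\ r \in R, r' \in R & L (r * h / r')]) ->
  False.
Proof.
move=> HF theta_inj thetaR thetaL LR.
pose RR := (R `*` R)%fset.
pose S := [fset r * r' | r in (1 |` R), r' in R]%fset.
have [E E0 ES] := HF S #|` RR|%fset.
set SE := [fset _ | _ in _, _ in _]%fset in ES.
pose P (p : H * H) h := `[< L (p.1 * h / p.2) >].
have small p : p \in RR ->
    (#|` E|%fset + #|` [fset h in E | P p h]|%fset <= #|` SE|%fset)%N.
  case: p => r r'; rewrite in_fsetM => /andP[/= rR r'R].
  (* [T] and [B] both lie in [SE]; they are disjoint because a common point would give a value of
     [theta] in [L]. *)
  pose T := [fset theta (r * h / r') * r' | h in E]%fset.
  pose B := [fset r * h | h in [fset h in E | P (r, r') h]]%fset.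
  have <- : #|` T|%fset = #|` E|%fset.
    by apply: card_imfset => h k /= /mulIg /theta_inj /mulIg /mulgI.
  have <- : #|` B|%fset = #|` [fset h in E | P (r, r') h]|%fset.
    by apply: card_imfset => h k /= /mulgI.
  have TB : [disjoint T & B]%fset.
    apply/fdisjointP => _ /imfsetP[h /= _ ->]; apply/imfsetP => -[k /=].
    rewrite !inE => /andP[_ /asboolP/= Lk] e; apply: (thetaL (r * h / r')).
    by rewrite -[theta _](mulgK r') e.
  rewrite -cardfsUI (eqP TB) cardfs0 addn0 fsubset_leq_card//.
  apply/fsubsetP => x; rewrite in_fsetU => /orP[] /imfsetP[h /= hE ->].
    have [q qR ->] := thetaR (r * h / r').
    rewrite !mulgA mulgVK; apply/imfset2P; exists (q * r) => /=.
      by apply/imfset2P; exists q; [rewrite !inE qR orbT|exists r].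
    by exists h.
  move: hE; rewrite !inE => /andP[hE _]; apply/imfset2P; exists r => /=.
    by apply/imfset2P; exists 1; [rewrite !inE eqxx|exists r; rewrite ?mul1g].
  by exists h.
(* Double counting: each [h] in [E] satisfies [P p] for at least one pair [p]. *)
have : (#|` RR|%fset * #|` E|%fset
        <= \sum_(p <- RR) #|` RR|%fset * #|` [fset h in E | P p h]|%fset)%N.
  rewrite -big_distrr /= leq_mul2l; apply/orP; right.
  have cardE p : #|` [fset h in E | P p h]|%fset = (\sum_(h <- E) P p h)%N.
    rewrite card_fset_sum1 -big_fset_condE big_mkcond /=.
    by apply: eq_bigr => h _; case: (P p h).
  under eq_bigr do rewrite cardE.
  rewrite exchange_big card_fset_sum1 /=.
  rewrite big_seq [leqRHS]big_seq; apply: leq_sum => h hE.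
  have [r [r' [rR r'R Lrr']]] := LR h.
  have RRrr' : (r, r') \in RR by rewrite in_fsetM rR.
  by rewrite (big_fsetD1 _ RRrr') /= /P asboolT.
apply/negP; rewrite -ltnNge big_seq.
(* The Folner bound for [#|] RR|[together with]small[makes every term of that sum smaller
   than]#|[E|]; the sum over the nonempty [RR] is then too small. *)
have bound p : p \in RR ->
    (#|` RR|%fset * #|` [fset h in E | P p h]|%fset < #|` E|%fset)%N.
  move=> pRR; rewrite -(ltn_add2l (#|` RR|%fset * #|` E|%fset)) -mulnDr.
  rewrite -mulSnr; apply: leq_ltn_trans ES.
  by rewrite leq_mul2l small// orbT.
have RR0 : (0 < #|` RR|%fset)%N.
  have [r [r' [rR r'R _]]] := LR 1; rewrite cardfs_gt0; apply/fset0Pn.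
  by exists (r, r'); rewrite in_fsetM rR.
have -> : (#|` RR|%fset * #|` E|%fset = \sum_(p <- RR) #|` E|%fset)%N.
  by rewrite big_const_seq count_predT iter_addn_0 mulnC.
rewrite [ltnRHS]big_seq; apply: leq_trans (leq_sum _ bound).
rewrite -!big_seq; under [leqRHS]eq_bigr do rewrite -addn1.
by rewrite big_split /= -card_fset_sum1 -addn1 leq_add2l.
Qed.

Variables (G H : groupType) (X Y : topologicalType).
Variables (s : system G X) (t : system H Y) (phi : X -> Y) (psi : Y -> X).
Variables (a : G -> X -> H) (b : H -> Y -> G).
Hypotheses (X_compact : compact [set: X]).
Hypotheses (phi_c : continuous phi) (psi_c : continuous psi).
Hypotheses (phiK : cancel phi psi) (psiK : cancel psi phi).
Hypotheses (bl : forall h, lconst (b h)).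
Hypothesis phiE : forall g x, phi (s g x) = t (a g x) (phi x).
Hypothesis psiE : forall h y, psi (t h y) = s (b h y) (psi y).
Hypothesis baK : forall g x, b (a g x) (phi x) = g.
Hypothesis abK : forall h y, a (b h y) (psi y) = h.
Hypothesis aM : forall g k x, a (g * k) x = a g (s k x) * a k x.
Hypotheses (t_free : topologically_free t).
Hypotheses (G_torsion_free : torsion_free G).
Hypothesis H_folner : folner (fun x y : H => x * y).
Variables (u : X -> H) (rho : G -> H) (x0 : X).
Hypothesis ul : lconst u.
Hypothesis uE : forall g x, u (s g x) * a g x = rho g * u x.

Let Phi x := t (u x) (phi x).

Lemma rhoM : {morph rho : g k / g * k}.
Proof.
move=> g k; apply: (mulIg (u x0)).
by rewrite -uE aM sactM mulgA uE -mulgA uE mulgA.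
Qed.

Lemma PhiE g x : Phi (s g x) = t (rho g) (Phi x).
Proof. by rewrite /Phi phiE -!sactM uE. Qed.

Lemma rho1 : rho 1 = 1.
Proof. by apply: (mulgI (rho 1)); rewrite -rhoM !mulg1. Qed.

(** If [rho g = 1], then [a (g ^+ n) x0] is [(u (s (g ^+ n) x0))^-1 * u x0], which takes finitely
    many values, although it is injective in [n] when [g] has infinite order. *)
Lemma rho_injective g : rho g = 1 -> g = 1.
Proof.
move=> rg; apply: contrapT => g1.
have gN : ~ torsion g by move=> [n [n0 /(G_torsion_free n0)]].
have rX n : rho (g ^+ n) = 1.
  by elim: n => [|n IHn]; [exact: rho1|rewrite expgS rhoM rg IHn mulg1].
have aX_inj : injective (fun n => a (g ^+ n) x0).
  move=> m n /(congr1 (b^~ (phi x0))); rewrite !baK; exact: expg_inj.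
have Df := finite_image (fun v => v^-1 * u x0) (lconst_finite X_compact ul).
apply: infinite_nat; apply: sub_finite_set (finite_preimage (in2W aX_inj) Df).
move=> n _ /=; exists (u (s (g ^+ n) x0)); first by exists (s (g ^+ n) x0).
by have := uE (g ^+ n) x0; rewrite rX mul1g => <-; rewrite mulKg.
Qed.

(** Removing [u] gives [k] carrying [phi x] to [phi x'], and the orbit equivalence turns [k] into
    [g]. Near [x] the values of [b k], [u] and [u \o s g] are constant, so [rho g] and [h] act alike
    on an open set. *)
Lemma Phi_orbit h x x' : t h (Phi x) = Phi x' ->
  exists g, x' = s g x /\ rho g = h.
Proof.
move=> hx; pose k := (u x')^-1 * h * u x; pose g := b k (phi x).
have kx : t k (phi x) = phi x'.
  rewrite /k -mulgA !sactM -/(Phi x) hx /Phi -sactM mulVg sact1 //.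
have gx : x' = s g x by rewrite -[x']phiK -kx psiE phiK.
exists g; split=> //; apply: (mulIg (u x)).
apply: (@free_phi_eq H X Y t phi psi psi_c phiK psiK _ _ x t_free).
have near_b : \forall z \near x, b k (phi z) = g.
  exact: (phi_c (bl k (phi x))).
have near_u : \forall z \near x, u (s g z) = u x'.
  by rewrite gx; apply: (lconst_continuous (@sact_continuous _ _ s g) ul).
move: near_b near_u (ul x); apply: filterS3 => z bz ugz uz.
rewrite -{1}uz sactM -/(Phi z) -PhiE /Phi ugz.
have -> : phi (s g z) = t k (phi z).
  by rewrite -bz -[z in s _ z]phiK -psiE psiK.
by rewrite -sactM /k !mulgA mulgV mul1g.
Qed.

Lemma Phi_inj : injective Phi.
Proof.
move=> x x' e; have [|g [-> /rho_injective ->]] := @Phi_orbit 1 x x'.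
  by rewrite sact1.
by rewrite sact1.
Qed.

Lemma Phi_surj y : exists x, Phi x = y.
Proof.
apply: contrapT => yPhi; have uf := lconst_finite X_compact ul.
pose R := fset_set (range u); pose theta h := u (psi (t h y)) * h.
have uR x : u x \in R by rewrite in_fset_set//; apply: mem_set; exists x.
have thetaE h : t (theta h) y = Phi (psi (t h y)).
  by rewrite /theta sactM /Phi psiK.
apply: (@folner_displacement H (range rho) R theta H_folner).
- move=> h k hk; have : Phi (psi (t h y)) = Phi (psi (t k y)).
    by rewrite -!thetaE hk.
  move=> /Phi_inj e; move: hk; rewrite /theta e; exact: mulgI.
- by move=> h; exists (u (psi (t h y))).
- move=> h [g _ gh]; apply: yPhi; exists (s g^-1 (psi (t h y))).
  by rewrite PhiE -thetaE -gh -sactM -rhoM mulVg rho1 sact1.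
(* The relation [uE] at [psi y] for the group element [b h y] expresses [h] through [rho (b h y)]
   and two values of [u]. *)
- move=> h; exists (u (psi (t h y))), (u (psi y)); split=> //.
  exists (b h y) => //; apply: (mulIg (u (psi y))).
  by rewrite -uE -psiE abK mulgVK.
Qed.

Lemma cocycle_conjugate : conjugate s t.
Proof.
have [Psi PsiK] := choice Phi_surj.
have PhiK : cancel Phi Psi by move=> x; apply: Phi_inj; rewrite PsiK.
have Phi_c : continuous Phi.
  move=> x; have c : {for x, continuous (t (u x) \o phi)}.
    by apply: continuous_comp; [exact: phi_c|exact: sact_continuous].
  move=> P /c Px; move: (ul x) Px; apply: filterS2 => z uz /=.
  by rewrite /Phi uz.
have Psi_c : continuous Psi.
  move=> y; rewrite -[y]PsiK; set x := Psi y => P Px.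
  (* Since [u] is constant near [x], the continuous map [q] agrees with [Psi] near [Phi x]. *)
  pose q y' := psi (t (u x)^-1 y').
  have qx : q (Phi x) = x by rewrite /q /Phi -sactM mulVg sact1 phiK.
  have qc : {for Phi x, continuous q}.
    by apply: continuous_comp; [exact: sact_continuous|exact: psi_c].
  have uq : nbhs (q (Phi x)) [set z | u z = u x] by rewrite qx; exact: (ul x).
  have Pq : nbhs (q (Phi x)) P by rewrite qx; rewrite PhiK in Px.
  suff : \forall z \near Phi x, P (Psi z) by [].
  have uqz : \forall z \near Phi x, u (q z) = u x := qc _ uq.
  have Pqz : \forall z \near Phi x, P (q z) := qc _ Pq.
  apply: filterS2 uqz Pqz => z uz.
  suff -> : Psi z = q z by [].
  by apply: Phi_inj; rewrite PsiK /Phi uz /q psiK -sactM mulgV sact1.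
pose rho_m : {multiplicative G -> H} :=
  HB.pack rho (monoid.isMultiplicative.Build G H rho rhoM).
exists Phi, Psi, rho_m; split; [by split| |exact: PhiE].
have rho_inj : injective rho.
  move=> g k gk; apply: (mulIg k^-1); rewrite mulgV; apply: rho_injective.
  by rewrite rhoM gk -rhoM mulgV rho1.
have rho_surj h : exists g, rho g = h.
  have [|g [_ <-]] := @Phi_orbit h x0 (Psi (t h (Phi x0))).
    by rewrite PsiK.
  by exists g.
have [r rK] := choice rho_surj.
by exists r => // g; apply: rho_inj; rewrite rK.
Qed.

End Conjugacy.

Theorem theorem1p3 (G H : groupType) (X Y : topologicalType)
    (s : system G X) (t : system H Y)
    (G_countable : countable [set: G]) (H_countable : countable [set: H])
    (X_lc : locally_compact [set: X]) (X_hausdorff : hausdorff_space X)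
    (Y_lc : locally_compact [set: Y]) (Y_hausdorff : hausdorff_space Y)
    (G_torsion_free : torsion_free G)
    (H_fg : finitely_generated H) (H_nilpotent : nilpotent_group H)
    (H_not_vZ : ~ virtually_infinite_cyclic H)
    (X_compact : compact [set: X])
    (s_free : topologically_free s)
    (s_projective : almost_ZG_projective s)
    (t_free : topologically_free t) :
  continuously_orbit_equivalent s t -> conjugate s t.
Proof.
move=> [phi [psi [a' [b' [[phi_c psi_c phiK psiK] a'c b'c phiE psiE]]]]].
pose a (g : G) x : H := a' (g, x); pose b (h : H) y : G := b' (h, y).
have al g : lconst (a g) := lconst_cocycle a'c g.
have bl h : lconst (b h) := lconst_cocycle b'c h.
have aM := orbit_cocycleM psi_c phiK psiK al phiE t_free.
have bM := orbit_cocycleM phi_c psiK phiK bl psiE s_free.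
have baK := orbit_cocycleK phiK al bl phiE psiE s_free phi_c.
have abK := orbit_cocycleK psiK bl al psiE phiE t_free psi_c.
(* On an empty space all constants coincide, contradicting injectivity on the summand of
   integers. *)
have [x0 _] : exists x : X, True.
  have [P [_ [Phi [[Psi PhiK _] Phi1]]]] := s_projective.
  apply: contrapT => X0; suff : (1 : int)%R = 0%R by [].
  have : Phi (1%R, 0%R) = Phi (0%R, 0%R).
    by rewrite !Phi1; apply: CXZP => x; case: X0; exists x.
  by move=> /(can_inj PhiK)[].
have Y_compact : compact [set: Y].
  have -> : [set: Y] = phi @` [set: X].
    by apply/seteqP; split=> // y _; exists (psi y); rewrite ?psiK.
  by apply: continuous_compact => //; exact: continuous_subspaceT.
have H_rigid := nilpotent_almost_invariant_rigid H_fg H_nilpotent H_not_vZ.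
have [n /lower_central_class Hn] := H_nilpotent.
have G_rigid : almost_invariant_rigid G.
  apply: (@orbit_equivalence_rigid G H X Y a b t x0 (phi x0)) H_rigid => //.
  by move=> h; rewrite -[x0 in a _ x0]phiK.
have [u [rho [ul uE]]] :=
  cocycle_rigidity X_compact G_rigid s_projective Hn al aM.
exact: (cocycle_conjugate X_compact phi_c psi_c phiK psiK bl phiE psiE baK abK
  aM t_free G_torsion_free (folner_class_le Hn) x0 ul uE).
Qed.
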